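(* Let $\xi,\xi_1,\xi_2,\ldots$ be i.i.d. nonnegative random variables, $S_n=\xi_1+\dots+\xi_n$, and let $\widehat S_1,\widehat S_2,\ldots$ be independent random variables such that $\widehat S_n$ has the same law as $S_n$ for each $n\in\mathbb N$. Assume $\mathbb P\{\xi>t\}\sim t^{-\alpha}\ell(t)$ as $t\to\infty$ for some $\alpha>0$ and some $\ell$ slowly varying at $\infty$. (a) If $\alpha\in(0,1)$, then $$\lim_{t\to\infty}\Big(-\log\mathbb P\Big\{\min_{n\ge1}\widehat S_n>t\Big\}\Big)\,\mathbb P\{\xi>t\}=\int_0^\infty-\log\mathbb P\{W_\alpha^{\leftarrow}(1)\le x\}\,\mathrm dx<\infty.$$ (b) If $\alpha>1$, then $$\lim_{t\to\infty}\frac{-\log\mathbb P\{\min_{n\ge1}\widehat S_n>t\}}{t\log t}=\frac{\alpha-1}{\mu},$$ where $\mu=\mathbb E\xi<\infty$.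
   Context: For $\alpha\in(0,1)$, $(W_\alpha(t))_{t\ge0}$ is a drift-free $\alpha$-stable subordinator with $-\log\mathbb E\exp(-zW_\alpha(t))=\Gamma(1-\alpha)\,t\,z^\alpha$ for $z\ge0$ ($\Gamma$ is Euler's gamma function), and $W_\alpha^{\leftarrow}(t):=\inf\{s\ge0:W_\alpha(s)>t\}$, $t\ge0$, is its inverse. (The law of $W_\alpha^{\leftarrow}(1)$ is a Mittag-Leffler distribution: $\mathbb E\exp(s\Gamma(1-\alpha)W_\alpha^{\leftarrow}(1))=\sum_{n\ge0}s^n/\Gamma(1+n\alpha)$, $s\ge0$.) *)

(* Defs.v *)
(* MathComp-Analysis *)
From HB Require Import structures.
From mathcomp Require Export all_boot all_order all_algebra finmap.
From mathcomp Require Export all_classical all_reals all_analysis.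
Export Order.TTheory GRing.Theory Num.Theory.
Export numFieldNormedType.Exports.

Set Implicit Arguments.
Unset Strict Implicit.
Unset Printing Implicit Defensive.

Local Open Scope classical_set_scope.
Local Open Scope ring_scope.

(* Mutual independence of the subfamily (X i)_(i in D). *)
Definition independent d (T : measurableType d) (R : realType)
    (P : probability T R) (I : choiceType) (D : set I) (X : I -> T -> R) :=
  forall (J : {fset I}) (B : I -> set R),
    [set` J] `<=` D -> (forall i, measurable (B i)) ->
    P (\bigcap_(i in [set` J]) (X i @^-1` B i)) =
      (\prod_(i <- J) P (X i @^-1` B i))%E.

Definition same_law d d' (T : measurableType d) (T' : measurableType d')
    (R : realType) (P : probability T R) (P' : probability T' R)
    (X : T -> R) (Y : T' -> R) :=
  forall B : set R, measurable B -> P (X @^-1` B) = P' (Y @^-1` B).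

Definition iid d (T : measurableType d) (R : realType) (P : probability T R)
    (X : nat -> T -> R) :=
  independent P setT X /\ forall n, same_law P P (X n) (X 0%N).

Definition partial_sum (T : Type) (R : realType) (X : nat -> T -> R)
    (n : nat) (w : T) : R :=
  \sum_(1 <= k < n.+1) X k w.

(* An infimum, so that it is defined at every point; in the theorem it is
   almost surely attained. *)
Definition min_ge1 (T : Type) (R : realType) (X : nat -> T -> R) (w : T)
    : \bar R :=
  ereal_inf [set (X n w)%:E | n in [set n : nat | (1 <= n)%N]].

Definition slowly_varying (R : realType) (l : R -> R) :=
  (exists a : R, measurable_fun `[a, +oo[ l /\ forall t, a <= t -> 0 < l t) /\
  forall c : R, 0 < c -> l (c * t) / l t @[t --> +oo] --> (1 : R).

Definition Gamma (R : realType) (a : R) : R :=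
  \int[lebesgue_measure]_(x in `]0, +oo[) (x `^ (a - 1) * expR (- x)).

(* Time is [0, +oo[: the values W t for t < 0 are unconstrained. *)
Record subordinator d (T : measurableType d) (R : realType)
    (Q : probability T R) (W : R -> {RV Q >-> R}) : Prop := Subordinator {
  sub_start : forall w, W 0 w = 0 ;
  sub_ndecr : forall w s t, 0 <= s -> s <= t -> W s w <= W t w ;
  sub_rcont : forall w t, 0 <= t -> W s w @[s --> t^'+] --> W t w ;
  sub_indep : forall t : nat -> R, 0 <= t 0%N ->
    (forall i, t i <= t i.+1) ->
    independent Q setT (fun i w => W (t i.+1) w - W (t i) w) ;
  sub_stationary : forall s t, 0 <= s -> 0 <= t ->
    same_law Q Q (fun w => W (s + t) w - W s w) (W t) }.

(* The Laplace exponent determines the law of a subordinator; this one is that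
   of an alpha-stable subordinator with zero drift. *)
Definition stable_subordinator d (T : measurableType d) (R : realType)
    (Q : probability T R) (alpha : R) (W : R -> {RV Q >-> R}) :=
  subordinator W /\
  forall t z : R, 0 <= t -> 0 <= z ->
    (- lne 'E_Q[fun w => expR (- z * W t w)] =
     (Gamma (1 - alpha) * t * z `^ alpha)%:E)%E.

(* The value is +oo when W never exceeds t. *)
Definition inverse_process (T : Type) (R : realType) (W : R -> T -> R)
    (t : R) (w : T) : \bar R :=
  ereal_inf [set s%:E | s in [set s : R | 0 <= s /\ t < W s w]].

(* Main.v *)
(* By independence, - ln P(min S_n > t) is the sum over n of - ln p_n(t), where
   p_n(t) = P(S_n > t). Put F(t) = P(xi > t).

   For alpha < 1, F(t) times this sum is the integral over x > 0 of the step
   function - ln p_n(t) with n = floor(x / F(t)) + 1. As n F(t) tends to x, the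
   Laplace transform of S_n / t tends to that of W(x), so that p_n(t) tends to
   P(W(x) > 1) = P(W^{<-}(1) <= x). Since p_n(t) >= P(max xi_k > t)
   >= 1 - e^{-x}, dominated convergence applies.

   For alpha > 1, only the n up to about t / mu matter. If n <= (1 - d) t / mu,
   truncating the summands at a small multiple of t gives
   p_n(t) <= K t^{1 - beta} for every beta < alpha, while
   p_n(t) >= 1 - e^{-n F(t)} bounds the sum of - ln p_n(t) over
   n <= N = (1 + d) t / mu by about N (alpha ln t) - ln N!. For n >= N, p_n(t) is
   exponentially close to 1 by Chernoff's bound. *)

Require Import Defs.
From HB Require Import structures.
From mathcomp Require Import measurable_realfun.
From mathcomp Require Import ring lra.

Import HBNNSimple.

Set Implicit Arguments.
Unset Strict Implicit.
Unset Printing Implicit Defensive.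

Local Open Scope classical_set_scope.
Local Open Scope ring_scope.

(** The infimum of infinitely many $\widehat S_n$ may equal t although each of them exceeds t, so
    the product formula for P(min > t) is not immediate; it needs a second level s > t for the far
    indices. For alpha < 1, the law of W(x) is known only through its Laplace exponent, so tails
    converge only at points that carry no atom of the limit. Self-similarity supplies them: W(x) has
    the law of x^(1/alpha) W(1), whose atoms are countable, so 1 is an atom for at most countably
    many x, which the integral over x ignores. The asymptotics of 1 - E exp(-z xi / t) come from the
    Abelian half of Karamata's theorem, with Potter bounds as domination. For alpha > 1, a small n
    lets S_n exceed t essentially through one large summand, with probability about n F(t). The
    terms alpha ln t - ln n, summed over n <= N, lose ln N! = N ln N + O(N), and ln N = ln t + O(1):
    this turns alpha into alpha - 1 and matches the bound t^(1 - beta). The margins d and |beta -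
    alpha| tend to 0 only at the very end. *)

(** * Independence: from events to expectations of products *)

(** The identity extends from indicators to simple functions by linearity and to [f] by monotone
    convergence. The weights [g] and [h] allow one factor of a product to be treated while the
    others are frozen. *)
Lemma integral_mulr_preimage_eq d (T : measurableType d) (R : realType)
    (P : {measure set T -> \bar R}) (X : T -> R) (g h : T -> R) :
  measurable_fun setT X -> measurable_fun setT g -> measurable_fun setT h ->
  (forall w, 0 <= g w) -> (forall w, 0 <= h w) ->
  (forall B : set R, measurable B ->
     \int[P]_w (g w * \1_B (X w))%:E = \int[P]_w (h w * \1_B (X w))%:E)%E ->
  forall f : R -> R, measurable_fun setT f -> (forall x, 0 <= f x) ->
    (\int[P]_w (g w * f (X w))%:E = \int[P]_w (h w * f (X w))%:E)%E.
Proof.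
move=> mX mg mh g0 h0 gh f mf f0.
move/measurable_EFinP : (mf) => mEf.
pose s := nnsfun_approx measurableT mEf.
have sfun_case (k : T -> R) : measurable_fun setT k -> (forall w, 0 <= k w) ->
    (\int[P]_w (k w * f (X w))%:E =
     limn (fun n => \sum_(y \in range (s n))
        (y%:E * \int[P]_w (k w * \1_(s n @^-1` [set y]) (X w))%:E)))%E.
  move=> mk k0.
  transitivity (limn (fun n => \int[P]_w (k w * s n (X w))%:E)%E).
    rewrite -monotone_convergence//; last 3 first.
    - move=> n; apply/measurable_EFinP; apply: measurable_funM => //.
      exact: measurableT_comp.
    - by move=> n w _; rewrite lee_fin mulr_ge0.
    - move=> w _ a b ab; rewrite lee_fin ler_wpM2l//.
      exact/lefP/nd_nnsfun_approx.
    apply: eq_integral => w _; apply/esym/cvg_lim => //.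
    apply: cvg_EFin; first exact: nearW.
    rewrite /=; apply: cvgMr => /=.
    have := @cvg_nnsfun_approx _ _ _ _ measurableT _ mEf.
    move=> /(_ (fun x _ => f0 x) (X w) I).
    by move/fine_cvgP => [].
  congr (limn _); apply/funext => n.
  transitivity (\int[P]_w \sum_(y \in range (s n))
      (y%:E * (k w * \1_(s n @^-1` [set y]) (X w))%:E))%E.
    apply: eq_integral => w _.
    rewrite (fimfunE (s n) (X w)) mulrC mulr_fsuml -fsumEFin//.
    by apply: eq_fsbigr => y _; rewrite -EFinM; congr EFin; ring.
  rewrite ge0_integral_fsum//.
  - apply: eq_fsbigr => y /[!inE] -[x _ <-].
    rewrite ge0_integralZl_EFin//.
      by move=> w _; rewrite lee_fin mulr_ge0// indicE.
    apply/measurable_EFinP; apply: measurable_funM => //.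
    exact: measurableT_comp.
  - move=> y; apply: emeasurable_funM => //; apply/measurable_EFinP.
    by apply: measurable_funM => //; apply: measurableT_comp.
  - move=> y w _; have [yn|yn] := leP 0 y.
      by rewrite mule_ge0// lee_fin// mulr_ge0// indicE.
    rewrite (_ : s n @^-1` [set y] = set0) ?indic0 ?mulr0 ?mule0//.
    by apply/seteqP; split => // x /= sy; move: yn; rewrite -sy ltNge fun_ge0.
rewrite !sfun_case//; congr (limn _); apply/funext => n.
apply: eq_fsbigr => y _; congr (_ * _)%E; apply: gh.
exact: measurable_funPTI.
Qed.

(** Independence speaks of events, so the factors are converted one at a time. The induction carries
    a mixed product, functions over [s1] and indicators over [s2]: an indicator of [X x] may join
    [s2], and is then replaced by [f x] through the preceding lemma. *)
Lemma integral_prod_independent d (T : measurableType d) (R : realType)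
    (P : probability T R) (X : nat -> {RV P >-> R}) (f : nat -> R -> R)
    (s : seq nat) :
  independent P setT X -> uniq s ->
  (forall k, measurable_fun setT (f k)) -> (forall k x, 0 <= f k x) ->
  (forall k, \int[P]_w (f k (X k w))%:E < +oo)%E ->
  (\int[P]_w (\prod_(k <- s) f k (X k w))%:E =
   \prod_(k <- s) \int[P]_w (f k (X k w))%:E)%E.
Proof.
move=> indX us mf f0 foo.
suff {us} gen (s1 s2 : seq nat) (B : nat -> set R) : uniq (s1 ++ s2) ->
    (forall k, measurable (B k)) ->
    (\int[P]_w (\prod_(k <- s1) f k (X k w) *
                \prod_(k <- s2) \1_(B k) (X k w))%:E =
     \prod_(k <- s1) \int[P]_w (f k (X k w))%:E *
     \prod_(k <- s2) P (X k @^-1` B k))%E.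
  have := @gen s [::] (fun=> setT); rewrite cats0 => /(_ us (fun=> measurableT)).
  rewrite big_nil mule1 => <-.
  by apply: eq_integral => w _; rewrite big_nil mulr1.
elim: s1 s2 B => [|x s1 IH] s2 B us mB.
  rewrite big_nil mul1e.
  have /= := indX [fset k in s2]%fset B (fun _ _ => I) mB.
  have ps : perm_eq (enum_fset [fset k in s2]%fset) s2.
    by apply: uniq_perm => // y; rewrite !inE.
  rewrite (perm_big _ ps)/= => <-.
  transitivity (\int[P]_w (\1_(\bigcap_(i in [set` [fset k in s2]%fset])
       X i @^-1` B i) w)%:E)%E; last first.
    rewrite integral_indic ?setIT//.
    apply: fin_bigcap_measurable => [|k _]; last exact: measurable_funPTI.
    exact: finite_fset.
  apply: eq_integral => w _; rewrite big_nil mul1r; congr EFin.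
  rewrite indicE; case: (pselect ((\bigcap_(i in [set` [fset k in s2]%fset])
       X i @^-1` B i) w)) => h.
    rewrite mem_set// big_seq big1// => k ks; rewrite indicE mem_set//.
    by apply: h => /=; rewrite !inE.
  rewrite memNset//; apply/eqP; rewrite prodf_seq_eq0; apply/hasP => /=.
  move/existsNP : h => [k /not_implyP[/=]]; rewrite !inE => ks nB.
  by exists k => //; rewrite indicE memNset//.
have xs2 : x \notin s2.
  by move: us; rewrite /= mem_cat negb_or => /andP[/andP[]].
have pr0 (s3 : seq nat) w : 0 <= \prod_(k <- s3) f k (X k w).
  by apply: prodr_ge0 => k _.
have pi0 (s3 : seq nat) w : 0 <= \prod_(k <- s3) (\1_(B k) (X k w) : R).
  by apply: prodr_ge0 => k _; rewrite indicE.
have mpr (s3 : seq nat) : measurable_fun setT (fun w => \prod_(k <- s3) f k (X k w)).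
  by apply: measurable_prod => k _; exact: measurableT_comp.
have mpi (s3 : seq nat) : measurable_fun setT
     (fun w => \prod_(k <- s3) (\1_(B k) (X k w) : R)).
  by apply: measurable_prod => k _; apply: measurableT_comp.
have IH1 (C : set R) : measurable C ->
    (\int[P]_w ((\prod_(k <- s1) f k (X k w) *
                \prod_(k <- s2) \1_(B k) (X k w)) * \1_C (X x w))%:E =
     \prod_(k <- s1) \int[P]_w (f k (X k w))%:E *
     \prod_(k <- s2) P (X k @^-1` B k) * P (X x @^-1` C))%E.
  move=> mC; pose B' k := if k == x then C else B k.
  have us' : uniq (s1 ++ x :: s2).
    by rewrite (perm_uniq (permEl (perm_catCA s1 [:: x] s2))).
  have mB' k : measurable (B' k) by rewrite /B'; case: ifP.
  have := IH (x :: s2) B' us' mB'; rewrite !big_cons /B' eqxx.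
  have e2 (I : Type) (idx : I) op F1 F2 : (forall k, k != x -> F1 k = F2 k) ->
      \big[op/idx]_(k <- s2) F1 k = \big[op/idx]_(k <- s2) F2 k.
    move=> FF; rewrite big_seq [RHS]big_seq; apply: eq_bigr => k ks.
    by apply: FF; apply: contraNneq xs2 => <-.
  rewrite (e2 _ _ _ _ (fun k => P (X k @^-1` B k))); last by move=> k /negbTE->.
  move=> H; rewrite -muleA (muleC _ (P (X x @^-1` C))) -H//.
  apply: eq_integral => w _; rewrite big_cons eqxx.
  rewrite (e2 _ _ _ (fun k => \1_(if k == x then C else B k) (X k w) : R)
    (fun k => \1_(B k) (X k w) : R)); last by move=> k /negbTE ->.
  by congr EFin; ring.
pose c := (\prod_(k <- s1) \int[P]_w (f k (X k w))%:E *
     \prod_(k <- s2) P (X k @^-1` B k))%E.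
have c0 : (0 <= c)%E.
  apply: mule_ge0; apply: prode_ge0 => k _ //.
  by apply: integral_ge0 => w _; rewrite lee_fin.
have cfin : c \is a fin_num.
  rewrite fin_numM//; rewrite /c; apply: prode_fin_num => k _.
    rewrite ge0_fin_numE//.
    by apply: integral_ge0 => w _; rewrite lee_fin.
  by apply: fin_num_measure; exact: measurable_funPTI.
(* Against any indicator of [X x], the product of the other factors integrates like the constant
   [c]; so it does against [f x]. *)
have := @integral_mulr_preimage_eq _ _ _ P (X x)
  (fun w => \prod_(k <- s1) f k (X k w) * \prod_(k <- s2) \1_(B k) (X k w))
  (fun=> fine c) _ _ _ _ _ _ (f x) (mf x) (f0 x).
move=> H; rewrite big_cons.
transitivity (\int[P]_w (fine c * f x (X x w))%:E)%E.
  rewrite -H//.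
  - by apply: eq_integral => w _; rewrite big_cons; congr EFin; ring.
  - exact: measurable_funM.
  - by move=> w; rewrite mulr_ge0.
  - by move=> w; rewrite fine_ge0.
  - move=> C mC; rewrite IH1// -/c.
    under [RHS]eq_integral do rewrite EFinM.
    rewrite ge0_integralZl_EFin//; last 2 first.
      by apply/measurable_EFinP; exact: measurableT_comp.
      by rewrite fine_ge0.
    rewrite fineK//; congr (_ * _)%E.
    rewrite -[RHS]/(\int[P]_w (\1_(X x @^-1` C) w)%:E)%E.
    by rewrite integral_indic ?setIT//; exact: measurable_funPTI.
under eq_integral do rewrite EFinM.
rewrite ge0_integralZl_EFin//; last 3 first.
  by move=> w _; rewrite lee_fin.
  by apply/measurable_EFinP; exact: measurableT_comp.
  by rewrite fine_ge0.
by rewrite fineK// muleC muleA.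
Qed.

(** * The law of the minimum as an infinite product *)

Lemma min_ge1_measurable d (T : measurableType d) (R : realType)
    (P : probability T R) (X : nat -> {RV P >-> R}) (t : R) :
  measurable [set w | (t%:E < min_ge1 X w)%E].
Proof.
have mX n : measurable_fun setT (fun w => (X n w)%:E) by exact/measurable_EFinP.
have := measurable_fun_einfs mX 1 measurableT
  (emeasurable_itv `]t%:E, +oo[%O).
rewrite setTI; congr measurable; apply/seteqP; split => w /=.
  by rewrite in_itv/= andbT.
by rewrite in_itv/= andbT.
Qed.

Definition survival d (T : measurableType d) (R : realType)
  (P : probability T R) (X : T -> R) (t : R) : R := fine (P [set w | t < X w]).

Lemma preimage_gt d (T : measurableType d) (R : realType) (X : T -> R) (t : R) :
  [set w | t < X w] = X @^-1` `]t, +oo[.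
Proof. by apply/seteqP; split => w /=; rewrite in_itv/= andbT. Qed.

Section survival_theory.
Context d (T : measurableType d) (R : realType) (P : probability T R).
Variables (X : T -> R) (mX : measurable_fun setT X).

Lemma measurable_gt t : measurable [set w | t < X w].
Proof. by rewrite preimage_gt -[X in measurable X]setTI; exact: mX. Qed.

Lemma survivalE t : (survival P X t)%:E = P [set w | t < X w].
Proof. by rewrite fineK// fin_num_measure//; exact: measurable_gt. Qed.

Lemma survival_ge0 t : 0 <= survival P X t.
Proof. by rewrite fine_ge0. Qed.

Lemma survival_le1 t : survival P X t <= 1.
Proof. by rewrite -lee_fin survivalE probability_le1//; exact: measurable_gt. Qed.

Lemma survival_ni : {homo survival P X : s t / s <= t >-> t <= s}.
Proof.
move=> s t st; rewrite -lee_fin !survivalE le_measure ?inE//; try exact: measurable_gt.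
by move=> w /=; exact: le_lt_trans.
Qed.

End survival_theory.

Lemma prod_expR_ln (R : realType) (p : nat -> R) (r : seq nat) :
  (forall k, 0 < p k) ->
  \prod_(k <- r) p k = expR (- \sum_(k <- r) - ln (p k)).
Proof.
move=> p0; rewrite sumrN opprK expR_sum; apply: eq_bigr => k kr.
by rewrite lnK// posrE p0.
Qed.

Lemma ge_expR_bigcap d (T : measurableType d) (R : realType)
    (P : probability T R) (A : nat -> set T) (u : nat -> R) (c : R) :
  (forall n, measurable (A n)) ->
  (forall n, P (\bigcap_(i in `I_n) A i) =
             (expR (- \sum_(0 <= i < n) u i))%:E) ->
  (forall n, \sum_(0 <= i < n) u i <= c) ->
  ((expR (- c))%:E <= P (\bigcap_i A i))%E.
Proof.
move=> mA PA uc.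
pose B n := \bigcap_(i in `I_n) A i.
have mB n : measurable (B n) by apply: bigcap_measurableType.
have -> : \bigcap_i A i = \bigcap_n B n.
  apply/seteqP; split => w h /=; first by move=> n _ i _; exact: h.
  by move=> i _; apply: (h i.+1 I) => /=.
have cB : P (B n) @[n --> \oo] --> P (\bigcap_n B n).
  apply: nonincreasing_cvg_mu => //.
  - by rewrite (le_lt_trans (probability_le1 _ _))// ltry.
  - exact: bigcap_measurableType.
  - move=> m n mn; apply/subsetPset => w h i /= im.
    by apply: h => /=; rewrite (leq_trans im).
rewrite -(cvg_lim _ cB)//; apply: lime_ge; first by apply/cvg_ex; eexists; exact: cB.
by apply: nearW => n; rewrite PA lee_fin ler_expR lerN2.
Qed.

(** The upper bound uses finitely many indices. For the lower bound, the first N variables are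
    required to exceed t and the others to exceed s > t: then the infimum is at least the minimum of
    s and N values above t, hence above t. The price is the tail [r N] of the convergent series at
    level s, which vanishes as N grows. *)
Lemma lne_min_ge1 d (T : measurableType d) (R : realType)
    (P : probability T R) (X : nat -> {RV P >-> R}) (t s : R) :
  independent P [set n | (1 <= n)%N] X -> t < s ->
  (forall n, 0 < survival P (X n.+1) s) ->
  (\sum_(0 <= n <oo) (- ln (survival P (X n.+1) s))%:E < +oo)%E ->
  (- lne (P [set w | t%:E < min_ge1 X w]) =
   \sum_(0 <= n <oo) (- ln (survival P (X n.+1) t))%:E)%E.
Proof.
move=> indX ts ps0 sv.
have mX n : measurable_fun setT (X n) by exact: measurable_funPT.
pose u n := - ln (survival P (X n.+1) t).
pose v n := - ln (survival P (X n.+1) s).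
have pt0 n : 0 < survival P (X n.+1) t by rewrite (lt_le_trans (ps0 n))// survival_ni// ltW.
have v0 n : 0 <= v n by rewrite oppr_ge0 ln_le0// survival_le1.
have u0 n : 0 <= u n by rewrite oppr_ge0 ln_le0// survival_le1.
have uv n : u n <= v n by rewrite lerN2 ler_ln ?posrE// survival_ni// ltW.
have indA (tau : nat -> R) n : (forall n, 0 < survival P (X n.+1) (tau n)) ->
    P (\bigcap_(i in `I_n) [set w | tau i < X i.+1 w]) =
    (expR (- \sum_(0 <= i < n) - ln (survival P (X i.+1) (tau i))))%:E.
  move=> tau0; rewrite -prod_expR_ln//.
  have := indX [fset k in index_iota 1 n.+1]%fset (fun k => [set x | tau k.-1 < x]).
  have ps : perm_eq (enum_fset [fset k in index_iota 1 n.+1]%fset) (index_iota 1 n.+1).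
    by apply: uniq_perm => //; [exact: iota_uniq|move=> y; rewrite !inE].
  rewrite (perm_big _ ps)/= big_add1/= => H.
  transitivity (\prod_(0 <= i < n) P (X i.+1 @^-1` [set x | (tau i < x)%R]))%E; last first.
    rewrite -prodEFin; apply: eq_bigr => i _.
    by rewrite survivalE.
  rewrite -H; last 2 first.
    by move=> k /=; rewrite !inE mem_index_iota => /andP[].
    by move=> k; rewrite -set_itvoy; exact: measurable_itv.
  congr (P _); apply/seteqP; split => w /= h k /=.
    by rewrite !inE mem_index_iota; case: k => // k /andP[_ kn]; exact: h.
  by move=> kn; have := h k.+1; rewrite /= !inE mem_index_iota/= ltnS; apply.
set q := P _.
have mq : measurable [set w | (t%:E < min_ge1 X w)%E] by exact: min_ge1_measurable.
have qu n : (q <= (expR (- \sum_(0 <= i < n) u i))%:E)%E.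
  rewrite -indA// le_measure ?inE//.
    by apply: bigcap_measurableType => k _; exact: measurable_gt.
  move=> w /= h i _ /=; rewrite -lte_fin (lt_le_trans h)//.
  by apply: ereal_inf_lbound; exists i.+1.
have cv k : cvgn (fun n => \sum_(k <= i < n) (v i)%:E)%E.
  by apply: is_cvg_nneseries => n _ _; rewrite lee_fin.
have cu : cvgn (fun n => \sum_(0 <= i < n) (u i)%:E)%E.
  by apply: is_cvg_nneseries => n _ _; rewrite lee_fin.
have U_ge0 : (0 <= \sum_(0 <= i <oo) (u i)%:E)%E.
  by apply: nneseries_ge0 => n _ _; rewrite lee_fin.
have Ufin : (\sum_(0 <= i <oo) (u i)%:E)%E \is a fin_num.
  rewrite ge0_fin_numE// (le_lt_trans _ sv)//; apply: lee_nneseries => n _.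
    by move=> _; rewrite lee_fin.
  by rewrite lee_fin.
have Vfin N : (\sum_(N <= i <oo) (v i)%:E)%E \is a fin_num.
  rewrite ge0_fin_numE; last by apply: nneseries_ge0 => n _ _; rewrite lee_fin.
  rewrite (le_lt_trans _ sv)//.
  rewrite [leRHS](nneseries_split 0 N)//; last by move=> k _; rewrite lee_fin; exact: v0.
  by rewrite add0n leeDr// sume_ge0// => i _; rewrite lee_fin; exact: v0.
set U := fine (\sum_(0 <= i <oo) (u i)%:E)%E.
pose r N := fine (\sum_(N <= i <oo) (v i)%:E)%E.
have qN N : ((expR (- (U + r N)))%:E <= q)%E.
  pose tau i := if (i < N)%N then t else s.
  have tau0 n : 0 < survival P (X n.+1) (tau n) by rewrite /tau; case: ifP.
  apply: (@le_trans _ _ (P (\bigcap_i [set w | tau i < X i.+1 w]))).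
    apply: (@ge_expR_bigcap _ _ _ _ _
      (fun i => - ln (survival P (X i.+1) (tau i)))) => [n|n|n].
    - exact: measurable_gt.
    - exact: indA.
    - have le_U k : \sum_(0 <= i < k) u i <= U.
        rewrite -lee_fin fineK// -sumEFin; apply: nneseries_lim_ge => i _ _.
        by rewrite lee_fin.
      have [nN|Nn] := leqP n N.
        rewrite -[leLHS]addr0 lerD//.
          rewrite big_nat (eq_bigr u) -?big_nat// => i /andP[_ ni].
          by rewrite /tau (leq_trans ni nN).
        by rewrite /r fine_ge0//; apply: nneseries_ge0 => i _ _; rewrite lee_fin.
      rewrite (big_cat_nat (leq0n N) (ltnW Nn))//= lerD//.
        rewrite big_nat (eq_bigr u) -?big_nat// => i /andP[_ ni].
        by rewrite /tau ni.
      rewrite big_nat (eq_bigr v) -?big_nat//; last first.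
        by move=> i /andP[Ni _]; rewrite /tau ltnNge Ni.
      rewrite -lee_fin fineK// -sumEFin; apply: nneseries_lim_ge => i _ _.
      by rewrite lee_fin.
  rewrite le_measure ?inE//.
    by apply: bigcap_measurableType => k _; exact: measurable_gt.
  move=> w /= h.
  have [m [tm ms mlX]] : exists m, [/\ t < m, m <= s &
      forall i, (i < N)%N -> m <= X i.+1 w].
    have : forall i, (i < N)%N -> t < X i.+1 w.
      by move=> i iN; have := h i I; rewrite /tau iN.
    elim: (N) => [_|k IH tX]; first by exists s.
    have [m [tm ms mlX]] := IH (fun i ik => tX i (leqW ik)).
    exists (Num.min m (X k.+1 w)); split; first by rewrite lt_min tm tX/=.
      by rewrite ge_min ms.
    move=> i; rewrite ltnS leq_eqVlt => /orP[/eqP ->|ik].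
      by rewrite ge_min lexx orbT.
    by rewrite ge_min mlX.
  apply: (@lt_le_trans _ _ m%:E); first by rewrite lte_fin.
  apply: le_ereal_inf_tmp => _ [[//|i] _ <-]; rewrite lee_fin.
  have [iN|Ni] := ltnP i N; first exact: mlX.
  by rewrite (le_trans ms)// ltW//; have := h i I; rewrite /tau ltnNge Ni.
have qfin : q \is a fin_num by rewrite fin_num_measure.
have q0 : (0 < q)%E by rewrite (lt_le_trans _ (qN 0%N))// lte_fin expR_gt0.
have [q' q'E] : exists q', q = q'%:E by exists (fine q); rewrite fineK.
move: q0 qu qN; rewrite q'E lte_fin => q0 qu qN.
rewrite lne_EFin// -[RHS]fineK// -/U -EFinN; congr EFin.
apply/eqP; rewrite eq_le; apply/andP; split; last first.
  rewrite -lee_fin fineK//; apply: lime_le => //; apply: nearW => n.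
  rewrite sumEFin lee_fin lerNr -(expRK (- _)) ler_ln ?posrE ?expR_gt0//.
  by rewrite -lee_fin.
have cr : r N @[N --> \oo] --> (0 : R).
  apply: fine_cvg => /=; apply: nneseries_tail_cvg => // k _.
  by rewrite lee_fin.
have : (U + r N) @[N --> \oo] --> U + 0 by apply: cvgD => //; exact: cvg_cst.
rewrite addr0 => cUr; rewrite -(cvg_lim _ cUr)//; apply: limr_ge.
  by apply/cvg_ex; exists U.
apply: nearW => N; rewrite lerNl -(expRK (- (U + _))) ler_ln ?posrE ?expR_gt0//.
by rewrite -lee_fin.
Qed.

(** * Elementary bounds on -ln(1 - e^(-x)) *)

(** As e^x >= 1 + x, the left side is at most ln(1 + 1/x), and 1 + y^2 <= (1 + y)^2 with y =
    x^(-1/2). The logarithmic singularity at 0 is traded for a power that is integrable there. *)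
Lemma ln_one_sub_expRN_le (R : realType) (x : R) : 0 < x ->
  - ln (1 - expR (- x)) <= 2 * x `^ (- 2^-1).
Proof.
move=> x0; have e1 : 0 < 1 - expR (- x) by rewrite subr_gt0 expR_lt1 oppr_lt0.
have h1 : (1 + x^-1)^-1 <= 1 - expR (- x).
  have x1 : 0 < 1 + x by lra.
  have -> : (1 + x^-1)^-1 = 1 - (1 + x)^-1.
    by field; rewrite !gt_eqF//; lra.
  rewrite lerD2l lerN2 expRN lef_pV2 ?posrE ?expR_gt0//.
  exact: expR_ge1Dx.
have xi0 : 0 < x^-1 by rewrite invr_gt0.
have y1 : 0 < 1 + x^-1 by lra.
have h2 : - ln (1 - expR (- x)) <= ln (1 + x^-1).
  by rewrite lerNl -lnV ?posrE// ler_ln ?posrE// invr_gt0.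
apply: (le_trans h2); rewrite powRN.
have s0 : 0 < x `^ 2^-1 by rewrite powR_gt0.
have -> : x^-1 = (x `^ 2^-1)^-1 ^+ 2.
  rewrite exprVn -powR_mulrn ?powR_ge0// -powRrM mulVf// powRr1//.
  exact: ltW.
set y := (x `^ 2^-1)^-1.
have {}y0 : 0 < y by rewrite invr_gt0.
apply: (@le_trans _ _ (ln ((1 + y) ^+ 2))).
  by rewrite ler_ln ?posrE//; nra.
rewrite lnXn; last lra.
rewrite -mulr_natl; have : ln (1 + y) <= y by (apply: le_ln1Dx; lra).
lra.
Qed.

(** With u = e^(-x), -ln(1 - u) = ln(1 + u / (1 - u)) <= u / (1 - u). This gives the decay at
    infinity, for the integral over x and for the series over n alike. *)
Lemma ln_one_sub_expRN_le_expR (R : realType) (c x : R) : 0 < c -> c <= x ->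
  - ln (1 - expR (- x)) <= (1 - expR (- c))^-1 * expR (- x).
Proof.
move=> c0 cx; set u := expR (- x).
have u0 : 0 < u by exact: expR_gt0.
have uc : u <= expR (- c) by rewrite ler_expR lerN2.
have c1 : expR (- c) < 1 by rewrite expR_lt1 oppr_lt0.
have e1 : 0 < 1 - u by lra.
rewrite -lnV ?posrE//.
have -> : (1 - u)^-1 = 1 + u / (1 - u) by field; rewrite gt_eqF.
have ud0 : 0 < u / (1 - u) by rewrite divr_gt0.
apply: (le_trans (le_ln1Dx _)); first lra.
by rewrite mulrC ler_pM2r// lef_pV2 ?posrE; lra.
Qed.

Lemma one_sub_expRN_le (R : realType) (a : R) (n : nat) : 0 <= a -> a <= 1 ->
  1 - expR (- (n%:R * a)) <= 1 - (1 - a) ^+ n.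
Proof.
move=> a0 a1; rewrite lerD2l lerN2 -mulrN expRM_natl lerXn2r ?nnegrE ?expR_ge0//.
- by rewrite subr_ge0.
- exact: expR_ge1Dx.
Qed.

Lemma nneseries_expR_lty (R : realType) (c C : R) : 0 < c -> 0 <= C ->
  (\sum_(0 <= n <oo) (C * expR (- (n.+1%:R * c)))%:E < +oo)%E.
Proof.
move=> c0 C0.
have q1 : `|expR (- c)| < 1.
  by rewrite ger0_norm ?expR_ge0// expR_lt1 oppr_lt0.
have gs := @cvg_geometric_series _ (C * expR (- c)) _ q1.
rewrite (_ : (\sum_(0 <= n <oo) _)%E = ((C * expR (- c)) * (1 - expR (- c))^-1)%:E) ?ltry//.
apply/cvg_lim => //.
rewrite (_ : (fun n => _) = EFin \o series (geometric (C * expR (- c)) (expR (- c)))).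
  by apply: cvg_EFin; [exact: nearW|exact: gs].
apply/funext => n /=; rewrite /series/= -sumEFin; apply: eq_bigr => i _.
by rewrite -mulrN expRM_natl exprS mulrA.
Qed.

(** * Regular variation and Potter bounds *)

Lemma dyadic_bracket (R : realType) (x : R) : 1 <= x ->
  exists n, 2 ^+ n <= x /\ x < 2 ^+ n.+1.
Proof.
move=> x1; have /ex_minnP[[|n]] : exists n, (x < 2 ^+ n).
- exists (Num.truncn x).+1; have /andP[_ /lt_trans] := truncn_itv (le_trans ler01 x1).
  by apply; rewrite -natrX ltr_nat ltn_expl.
- by rewrite expr0 ltNge x1.
- move=> xn min; exists n; split=> //; rewrite leNgt; apply/negP => /min.
  by rewrite ltnn.
Qed.

Section potter.
Variables (R : realType) (F : R -> R) (alpha : R).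
Hypotheses (F_ni : {homo F : s t / s <= t >-> t <= s}) (F_gt0 : forall t, 0 < F t).
Hypothesis F2 : F (2 * t) / F t @[t --> +oo] --> 2 `^ (- alpha).

Let powR2_lt (a b : R) : a < b -> (2 : R) `^ a < 2 `^ b.
Proof. by move=> ab; rewrite /powR !gt_eqF// ltr_expR ltr_pM2r// ln_gt0// ltr1n. Qed.

(** The limit at ratio 2 gives F(2r) <= 2^(-beta) F(r) for large r, which is iterated along s, 2s,
    4s, ...; monotonicity fills the gaps, and the factor 2^beta pays for rounding t / s down to a
    power of 2. *)
Lemma potter_upper (beta : R) : 0 < beta -> beta < alpha ->
  exists2 t0 : R, 0 < t0 & forall s t : R, t0 <= s -> s <= t ->
    F t <= 2 `^ beta * (t / s) `^ (- beta) * F s.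
Proof.
move=> b0 ba.
have ba' : - alpha < - beta by rewrite ltrN2.
have [M [_ HM]] := cvgr_lt _ F2 _ (powR2_lt ba').
pose t0 := Num.max 1 (M + 1).
have t00 : 0 < t0 by rewrite lt_max ltr01.
exists t0 => // s t t0s st.
have step r : t0 <= r -> F (2 * r) <= 2 `^ (- beta) * F r.
  move=> t0r; rewrite -ler_pdivrMr//; apply/ltW/HM.
  by apply: lt_le_trans t0r; rewrite lt_max ltrDl ltr01 orbT.
have iter n : F (2 ^+ n * s) <= (2 `^ (- beta)) ^+ n * F s.
  elim: n => [|n IH]; first by rewrite !expr0 !mul1r.
  rewrite !exprS -!mulrA (le_trans (step _ _))//.
    by rewrite (le_trans t0s)// ler_peMl ?exprn_ege1 ?ler1n// ltW// (lt_le_trans t00).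
  by rewrite ler_wpM2l// powR_ge0.
have s0 : 0 < s by exact: lt_le_trans t0s.
have [|n [nl nr]] := @dyadic_bracket _ (t / s); first by rewrite ler_pdivlMr// mul1r.
have h : F t <= F (2 ^+ n * s) by apply: F_ni; rewrite -ler_pdivlMr.
apply: (le_trans h) => {h}.
apply: (le_trans (iter n)); rewrite ler_pM2r//.
rewrite -powR_mulrn ?powR_ge0// -powRrM !powRN mulNr powRN.
rewrite ler_pdivlMr ?powR_gt0 ?divr_gt0// ?(lt_le_trans s0)//.
rewrite mulrC ler_pdivrMr ?powR_gt0// mulrC -powRD ?pnatr_eq0 ?implybT//.
rewrite -[X in X + _]mulr1 -mulrDr nat1r.
rewrite [X in 2 `^ X](_ : _ = n.+1%:R * beta); last by rewrite -?natr1; ring.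
rewrite powRrM powR_mulrn//.
apply: ge0_ler_powR; rewrite ?nnegrE ?exprn_ge0 ?(ltW b0) ?[s^-1 * t]mulrC ?(ltW nr)//.
by rewrite ?[s^-1 * t]mulrC divr_ge0 ?ltW// (lt_le_trans s0).
Qed.

(** The same iteration with the inequality reversed; here t / s is rounded up, to 2^(n+1). *)
Lemma potter_lower (beta : R) : 0 < alpha -> alpha < beta ->
  exists2 t0 : R, 0 < t0 & forall s t : R, t0 <= s -> s <= t ->
    F s <= 2 `^ beta * (t / s) `^ beta * F t.
Proof.
move=> a0 ab; have b0 := lt_trans a0 ab.
have ba : - beta < - alpha by rewrite ltrN2.
have [M [_ HM]] := cvgr_gt _ F2 _ (powR2_lt ba).
pose t0 := Num.max 1 (M + 1).
have t00 : 0 < t0 by rewrite lt_max ltr01.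
exists t0 => // s t t0s st.
have step r : t0 <= r -> F r <= 2 `^ beta * F (2 * r).
  move=> t0r; rewrite mulrC -ler_pdivrMr ?powR_gt0// -powRN mulrC -ler_pdivlMr//.
  apply/ltW/HM.
  by apply: lt_le_trans t0r; rewrite lt_max ltrDl ltr01 orbT.
have iter n : F s <= (2 `^ beta) ^+ n * F (2 ^+ n * s).
  elim: n => [|n IH]; first by rewrite !expr0 !mul1r.
  apply: (le_trans IH); rewrite exprSr -[leRHS]mulrA ler_pM2l ?exprn_gt0 ?powR_gt0//.
  rewrite exprS -mulrA; apply: step.
  by rewrite (le_trans t0s)// ler_peMl ?exprn_ege1 ?ler1n// ltW// (lt_le_trans t00).
have s0 : 0 < s by exact: lt_le_trans t0s.
have [|n [nl nr]] := @dyadic_bracket _ (t / s); first by rewrite ler_pdivlMr// mul1r.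
apply: (le_trans (iter n.+1)).
apply: ler_pM; rewrite ?exprn_ge0 ?powR_ge0 ?(ltW (F_gt0 _))//; last first.
  by apply: F_ni; rewrite -ler_pdivrMr// ltW.
rewrite exprS ler_wpM2l ?powR_ge0//.
rewrite -powR_mulrn ?powR_ge0// -powRrM mulrC powRrM powR_mulrn//.
apply: ge0_ler_powR; rewrite ?nnegrE ?exprn_ge0 ?(ltW b0) ?nl//.
by rewrite divr_ge0 ?ltW// (lt_le_trans s0).
Qed.

End potter.

Lemma regular_ratio (R : realType) (F l : R -> R) (alpha c : R) :
  (forall t, 0 < F t) -> slowly_varying l ->
  F t / (t `^ (- alpha) * l t) @[t --> +oo] --> (1 : R) -> 0 < c ->
  F (c * t) / F t @[t --> +oo] --> c `^ (- alpha).
Proof.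
move=> F0 [[a [_ la]] lc] Fl c0.
have ct : c * t @[t --> +oo] --> +oo by exact: gt0_cvgMry.
have h1 : F (c * t) / ((c * t) `^ (- alpha) * l (c * t)) @[t --> +oo] --> (1 : R).
  exact: (cvg_comp _ _ ct Fl).
have h2 : (F t / (t `^ (- alpha) * l t))^-1 @[t --> +oo] --> (1 : R)^-1.
  by apply: cvgV => //; rewrite oner_neq0.
have h4 : c `^ (- alpha) @[t --> (+oo : set_system R)] --> c `^ (- alpha).
  exact: cvg_cst.
have h3 : (F (c * t) / ((c * t) `^ (- alpha) * l (c * t)) *
    (F t / (t `^ (- alpha) * l t))^-1) * (l (c * t) / l t * c `^ (- alpha))
    @[t --> +oo] --> 1 * 1^-1 * (1 * c `^ (- alpha)).
  exact: cvgM (cvgM h1 h2) (cvgM (lc c c0) h4).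
rewrite invr1 !mul1r in h3.
apply: cvg_trans h3; apply: near_eq_cvg; near=> t.
have t0 : 0 < t by near: t; exact: nbhs_pinfty_gt (num_real _).
have ta : a <= t by near: t; exact: nbhs_pinfty_ge (num_real _).
have tac : a <= c * t.
  by rewrite mulrC -ler_pdivrMr//; near: t; exact: nbhs_pinfty_ge (num_real _).
have l1 := la _ ta; have l2 := la _ tac.
have p1 : 0 < t `^ (- alpha) by rewrite powR_gt0.
have p2 : 0 < c `^ (- alpha) by rewrite powR_gt0.
rewrite /= powRM ?ltW//; field.
by rewrite !gt_eqF.
Unshelve. all: by end_near. Qed.

Lemma tail_gt0 (R : realType) (F l : R -> R) (alpha : R) :
  {homo F : s t / s <= t >-> t <= s} -> slowly_varying l ->
  F t / (t `^ (- alpha) * l t) @[t --> +oo] --> (1 : R) ->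
  forall t, 0 < F t.
Proof.
move=> Fni [[a [_ la]] _] Fl t.
suff : \forall s \near +oo, 0 < F s.
  move=> [M [_ HM]]; apply: lt_le_trans (Fni _ _ (_ : t <= Num.max t (M + 1))).
    by apply: HM; rewrite lt_max ltrDl ltr01 orbT.
  by rewrite le_max lexx.
near=> s.
have s0 : 0 < s by near: s; exact: nbhs_pinfty_gt (num_real _).
have sa : a <= s by near: s; exact: nbhs_pinfty_ge (num_real _).
have : 0 < F s / (s `^ (- alpha) * l s) by near: s; exact: cvgr_gt Fl _ ltr01.
by rewrite pmulr_lgt0// invr_gt0 mulr_gt0 ?powR_gt0 ?la.
Unshelve. all: by end_near. Qed.

(** * From Laplace transforms to tails *)

(** The second bound comes from n v <= (1 + v)^n and (1 + v)^n (1 - v)^n = (1 - v^2)^n <= 1. *)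
Lemma bernoulli_le (R : realType) (v : R) n : 0 <= v -> v <= 1 ->
  1 - n%:R * v <= (1 - v) ^+ n /\ n%:R * v * (1 - v) ^+ n <= 1.
Proof.
move=> v0 v1; split.
  elim: n => [|n IH]; first by rewrite mul0r subr0 expr0.
  rewrite exprS -natr1; have n0 : 0 <= (n%:R : R) by [].
  have p0 : 0 <= (1 - v) ^+ n by rewrite exprn_ge0// subr_ge0.
  by nra.
have h : 1 + n%:R * v <= (1 + v) ^+ n.
  elim: n => [|n IH]; first by rewrite mul0r addr0 expr0.
  rewrite exprS -natr1; have n0 : 0 <= (n%:R : R) by [].
  by nra.
have p0 : 0 <= (1 - v) ^+ n by rewrite exprn_ge0// subr_ge0.
apply: (@le_trans _ _ ((1 + v) ^+ n * (1 - v) ^+ n)).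
  by rewrite ler_wpM2r// (le_trans _ h)// lerDr.
rewrite -exprMn exprn_ile1//; nra.
Qed.

(* The witness is a Brosowski-Deutsch polynomial (1 - u^n)^(2^n) in
   u = 2^(-2y/(a+b)), which stands in for the continuity theorem for Laplace
   transforms. *)
Lemma exp_step_approx (R : realType) (a b e : R) : 0 < a -> a < b -> 0 < e ->
  exists m (c z : nat -> R), (forall j, 0 <= z j) /\
  forall y, 0 <= y -> let q := \sum_(0 <= j < m) c j * expR (- z j * y) in
    [/\ 0 <= q <= 1, y <= a -> q <= e & b <= y -> 1 - e <= q].
Proof.
move=> a0 ab e0.
have ab0 : 0 < a + b by lra.
have ln20 : 0 < ln (2 : R) by rewrite ln_gt0// ltr1n.
pose s : R := 2 * ln 2 / (a + b); have s0 : 0 < s by rewrite divr_gt0 ?mulr_gt0//; lra.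
(* 2^n v equals exp(n (ln 2 - s y)). The exponent changes sign at the midpoint of a and b; it is at
   least n [dl] for y <= a and at most -n [dl] for y >= b, and n is chosen so that e^(-n dl) <=
   e. *)
pose dl := ln 2 * (b - a) / (a + b).
have dl0 : 0 < dl by rewrite divr_gt0 ?mulr_gt0//; lra.
pose n := (Num.truncn (- ln e / dl)).+1.
have en : expR (- (n%:R * dl)) <= e.
  rewrite -[leRHS]lnK ?posrE// ler_expR lerNl -ler_pdivrMr//.
  have [h|h] := leP 0 (- ln e / dl); last by rewrite (le_trans (ltW h)).
  by have /andP[_ /ltW] := truncn_itv h.
exists (2 ^ n).+1, (fun j => (-1) ^+ j *+ 'C(2 ^ n, j)), (fun j => (n * j)%:R * s).
split=> [j|y y0 q]; first by rewrite mulr_ge0// ltW.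
pose u := expR (- s * y); pose v := u ^+ n.
have u0 : 0 < u by exact: expR_gt0.
have v0 : 0 < v by rewrite exprn_gt0.
have u1 : u <= 1 by rewrite expR_le1 mulNr oppr_le0 mulr_ge0// ltW.
have v1 : v <= 1 by rewrite exprn_ile1// ltW.
have qE : q = (1 - v) ^+ (2 ^ n).
  rewrite exprBn /q big_mkord; apply: eq_bigr => j _.
  rewrite expr1n mulr1 -mulrnAl; congr (_ * _).
  rewrite /v /u -!expRM_natl; congr expR; rewrite natrM; ring.
have [h1 h2] := @bernoulli_le _ v (2 ^ n) (ltW v0) v1.
have Nv : (2 ^ n)%:R * v = expR (n%:R * (ln 2 - s * y)).
  rewrite natrX /v -exprMn expRM_natl expRD lnK ?posrE//.
  by rewrite /u mulNr.
rewrite qE; split.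
- by rewrite exprn_ge0 ?subr_ge0//= exprn_ile1 ?subr_ge0// gerBl ltW.
- move=> ya; rewrite (le_trans _ en)// expRN -[leRHS]mul1r ler_pdivlMr ?expR_gt0//.
  rewrite mulrC (le_trans _ h2)// ler_wpM2r ?exprn_ge0 ?subr_ge0// Nv ler_expR.
  rewrite ler_wpM2l// /dl /s.
  rewrite -subr_ge0; have -> : ln 2 - 2 * ln 2 / (a + b) * y - ln 2 * (b - a) / (a + b)
    = 2 * ln 2 * (a - y) / (a + b) by field; rewrite gt_eqF.
  by rewrite divr_ge0 ?(ltW ab0)// mulr_ge0 ?subr_ge0// mulr_ge0// ltW.
- move=> byy; apply: le_trans h1; rewrite lerD2l lerN2 (le_trans _ en)//.
  rewrite Nv ler_expR -(mulrN _ dl) ler_wpM2l// /dl /s.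
  rewrite -subr_ge0; have -> : - (ln 2 * (b - a) / (a + b)) - (ln 2 - 2 * ln 2 / (a + b) * y)
    = 2 * ln 2 * (y - b) / (a + b) by field; rewrite gt_eqF.
  by rewrite divr_ge0 ?(ltW ab0)// mulr_ge0 ?subr_ge0// mulr_ge0// ltW.
Qed.

Definition laplace d (T : measurableType d) (R : realType)
    (P : probability T R) (X : T -> R) (z : R) : R :=
  \int[P]_w expR (- z * X w).

Lemma integrable_expRN d (T : measurableType d) (R : realType)
    (P : probability T R) (X : T -> R) (z : R) :
  measurable_fun setT X -> (forall w, 0 <= X w) -> 0 <= z ->
  P.-integrable setT (EFin \o (fun w => expR (- z * X w))).
Proof.
move=> mX X0 z0; apply: measurable_bounded_integrable => //.
- by rewrite (le_lt_trans (probability_le1 _ _))// ltry.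
- by apply: measurableT_comp => //; exact: measurable_funM.
- exists 1; split => // M M1 w _ /=.
  rewrite ger0_norm ?expR_ge0// (le_trans _ (ltW M1))// expR_le1 mulNr oppr_le0.
  exact: mulr_ge0.
Qed.

Lemma Rintegral_sum_expR d (T : measurableType d) (R : realType)
    (P : probability T R) (X : T -> R) m (c z : nat -> R) :
  measurable_fun setT X -> (forall w, 0 <= X w) -> (forall j, 0 <= z j) ->
  P.-integrable setT (EFin \o (fun w => \sum_(0 <= j < m) c j * expR (- z j * X w))) /\
  (\int[P]_w (\sum_(0 <= j < m) c j * expR (- z j * X w)))%R
   = \sum_(0 <= j < m) c j * laplace P X (z j).
Proof.
move=> mX X0 z0; elim: m => [|m [IH1 IH2]].
  split.
    apply: (eq_integrable _ (cst 0%E)) => //.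
      by move=> w _ /=; rewrite big_geq.
    exact: integrable0.
  rewrite big_geq// /Rintegral integral0_eq// => w _.
  by rewrite big_geq.
have ic : P.-integrable setT (EFin \o (fun w => c m * expR (- z m * X w))).
  rewrite (_ : _ \o _ = (fun w => (c m)%:E * (EFin \o (fun w => expR (- z m * X w))) w)%E)//.
  by apply: integrableZl => //; exact: integrable_expRN.
split.
  apply: (eq_integrable _ ((EFin \o (fun w => (\sum_(0 <= j < m) c j * expR (- z j * X w))%R))
     \+ (EFin \o (fun w => (c m * expR (- z m * X w))%R)))%E) => //.
    by move=> w _ /=; rewrite big_nat_recr.
  exact: integrableD.
under eq_Rintegral do rewrite big_nat_recr//=.
rewrite RintegralD// IH2 RintegralZl//; last exact: integrable_expRN.
by rewrite big_nat_recr.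
Qed.

Lemma Rintegral_gt d (T : measurableType d) (R : realType)
    (P : probability T R) (X : T -> R) (t : R) :
  measurable_fun setT X ->
  P.-integrable setT (EFin \o (\1_[set w | t < X w] : T -> R)) /\
  (\int[P]_w (\1_[set w | t < X w] w : R))%R = survival P X t.
Proof.
move=> mX; have mA : measurable [set w | t < X w].
  exact: measurable_gt.
split; first by apply: integrable_indic.
by rewrite /Rintegral integral_indic// setIT.
Qed.

Lemma same_law_integral d d' (T : measurableType d) (T' : measurableType d')
    (R : realType) (P : probability T R) (P' : probability T' R)
    (X : T -> R) (Y : T' -> R) (f : R -> R) :
  measurable_fun setT X -> measurable_fun setT Y -> same_law P P' X Y ->
  measurable_fun setT f -> (forall x, 0 <= f x) ->
  (\int[P]_w (f (X w))%:E = \int[P']_w (f (Y w))%:E)%E.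
Proof.
move=> mX mY XY mf f0.
have mEf : measurable_fun setT (EFin \o f) by exact/measurable_EFinP.
pose X' : {mfun T >-> R} := HB.pack X (isMeasurableFun.Build _ _ _ _ _ mX).
pose Y' : {mfun T' >-> R} := HB.pack Y (isMeasurableFun.Build _ _ _ _ _ mY).
have Ef0 y : (0 <= (EFin \o f) y)%E by rewrite /= lee_fin.
rewrite -[LHS](ge0_integral_distribution (X' : {RV P >-> R}) mEf Ef0).
rewrite -[RHS](ge0_integral_distribution (Y' : {RV P' >-> R}) mEf Ef0).
by apply: eq_measure_integral => /= A mA _; exact: XY.
Qed.

(** The approximate step q satisfies 1_(X > b) - e/3 <= q(X) <= 1_(X > a) + e/3, and E q(X) is a
    finite linear combination of values of the Laplace transform, hence converges. The gap between a
    and b stays because the limit may have atoms. *)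
Lemma laplace_survival_cvg d d' (T : measurableType d) (T' : measurableType d')
    (R : realType) (P : probability T R) (P' : probability T' R)
    (Y : nat -> T -> R) (Z : T' -> R) (a b e : R) :
  (forall k, measurable_fun setT (Y k)) -> (forall k w, 0 <= Y k w) ->
  measurable_fun setT Z -> (forall w, 0 <= Z w) ->
  (forall z, 0 <= z -> laplace P (Y k) z @[k --> \oo] --> laplace P' Z z) ->
  0 < a -> a < b -> 0 < e ->
  \forall k \near \oo, survival P (Y k) b <= survival P' Z a + e /\
                       survival P' Z b <= survival P (Y k) a + e.
Proof.
move=> mY Y0 mZ Z0 YZ a0 ab e0.
have e30 : 0 < e / 3 by rewrite divr_gt0.
have [m [c [z [z0 q]]]] := exp_step_approx a0 ab e30.
have sandwich d1 (T1 : measurableType d1) (P1 : probability T1 R) (X : T1 -> R) :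
    measurable_fun setT X -> (forall w, 0 <= X w) ->
    let S := \sum_(0 <= j < m) c j * laplace P1 X (z j) in
    survival P1 X b <= S + e / 3 /\ S <= survival P1 X a + e / 3.
  move=> mX X0 S.
  have [iq Eq] := Rintegral_sum_expR P1 m c mX X0 z0.
  have [ia Ea] := Rintegral_gt P1 a mX.
  have [ib Eb] := Rintegral_gt P1 b mX.
  have ie : P1.-integrable setT (EFin \o (fun=> e / 3)).
    exact: finite_measure_integrable_cst.
  have Ee : \int[P1]_w (e / 3) = e / 3.
    by rewrite Rintegral_cst//= probability_setT mulr1.
  have iD (f g : T1 -> R) : P1.-integrable setT (EFin \o f) ->
      P1.-integrable setT (EFin \o g) ->
      P1.-integrable setT (EFin \o (fun w => f w + g w)).
    move=> fi gi; rewrite (_ : _ \o _ = ((EFin \o f) \+ (EFin \o g))%E)//.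
    exact: integrableD.
  rewrite /S -Eq -Ea -Eb -Ee -!RintegralD//; split; apply: le_Rintegral => //.
  - exact: iD.
  - move=> w _; have [/andP[q0 q1] qa qb] := q (X w) (X0 w).
    rewrite /= indicE; have [h|h] := boolP (w \in _).
      by move: h; rewrite inE/= => /ltW/qb; rewrite lerBlDr.
    by rewrite addr_ge0// ltW.
  - exact: iD.
  - move=> w _; have [/andP[q0 q1] qa qb] := q (X w) (X0 w).
    rewrite /= indicE; have [h|h] := boolP (w \in _).
      by rewrite (le_trans q1)// lerDl ltW.
    by move: h; rewrite notin_setE/= add0r => /negP; rewrite -leNgt => /qa.
have cS : \sum_(0 <= j < m) c j * laplace P (Y k) (z j) @[k --> \oo] -->
    \sum_(0 <= j < m) c j * laplace P' Z (z j).
  elim: (m) => [|n IH].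
    under eq_cvg do rewrite big_geq//.
    by rewrite big_geq//; exact: cvg_cst.
  under eq_cvg do rewrite big_nat_recr//=.
  rewrite big_nat_recr//=; apply: cvgD => //.
  by apply: cvgM; [exact: cvg_cst|exact: YZ].
have [Z1 Z2] := sandwich _ _ P' Z mZ Z0.
near=> k.
have [Y1 Y2] := sandwich _ _ P (Y k) (mY k) (Y0 k).
have : `|\sum_(0 <= j < m) c j * laplace P' Z (z j) -
    \sum_(0 <= j < m) c j * laplace P (Y k) (z j)| < e / 3.
  by near: k; exact: cvgr_dist_lt cS _ e30.
rewrite ltr_norml => /andP[h1 h2].
set u := \sum_(0 <= j < m) _ in Y1 Y2 h1 h2.
set v := \sum_(0 <= j < m) _ in Z1 Z2 h1 h2.
have e3E : e = e / 3 + e / 3 + e / 3 by field.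
by rewrite e3E; split; clear - Y1 Y2 Z1 Z2 h1 h2; lra.
Unshelve. all: by end_near. Qed.

(** * Laplace transforms of sums of i.i.d. variables *)

Lemma partial_sum_measurable d (T : measurableType d) (R : realType)
    (P : probability T R) (X : nat -> {RV P >-> R}) n :
  measurable_fun setT (partial_sum X n).
Proof. by apply: measurable_sum => k; exact: measurable_funPT. Qed.

Lemma integral_prod_iid d (T : measurableType d) (R : realType)
    (P : probability T R) (X : nat -> {RV P >-> R}) (f : R -> R) n :
  iid P X -> measurable_fun setT f -> (forall x, 0 <= f x) ->
  (\int[P]_w (f (X 0%N w))%:E < +oo)%E ->
  (\int[P]_w (\prod_(1 <= k < n.+1) f (X k w))%:E =
   (\int[P]_w (f (X 0%N w))%:E) ^+ n)%E.
Proof.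
move=> [indX sameX] mf f0 foo.
have same k : (\int[P]_w (f (X k w))%:E = \int[P]_w (f (X 0%N w))%:E)%E.
  by apply: same_law_integral => //; exact: measurable_funPT.
rewrite (integral_prod_independent (f := fun=> f))//; last 2 first.
- exact: iota_uniq.
- by move=> k; rewrite same.
rewrite (eq_bigr (fun=> \int[P]_w (f (X 0%N w))%:E)%E)//.
rewrite big_const_nat subn1/=; elim: n => [//|n IH].
by rewrite expeS -IH.
Qed.

Lemma laplace_partial_sum d (T : measurableType d) (R : realType)
    (P : probability T R) (X : nat -> {RV P >-> R}) n (z : R) :
  iid P X -> (forall w, 0 <= X 0%N w) -> 0 <= z ->
  laplace P (partial_sum X n) z = laplace P (X 0%N) z ^+ n.
Proof.
move=> iX X0 z0.
have iz := integrable_expRN P (measurable_funPT (X 0%N)) X0 z0.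
have fz : (\int[P]_w (expR (- z * X 0%N w))%:E)%E \is a fin_num.
  exact: integrable_fin_num.
rewrite /laplace /Rintegral.
transitivity (fine ((\int[P]_w (expR (- z * X 0%N w))%:E)%E ^+ n)).
  rewrite -(integral_prod_iid (f := fun x => expR (- z * x)))//.
  - congr fine; apply: eq_integral => w _; congr EFin.
    by rewrite -expR_sum /partial_sum mulr_sumr.
  - by apply: measurableT_comp => //; exact: measurable_funM.
  - by rewrite ltey_eq fz.
by rewrite -[in LHS](fineK fz) -EFin_expe.
Qed.

(** * Behaviour of the Laplace transform at 0 for a regularly varying tail *)

Lemma integral_expRN (R : realType) (y : R) : 0 <= y ->
  (\int[lebesgue_measure]_(v in `]0%R, y]) (expR (- v))%:E = (1 - expR (- y))%:E)%E.
Proof.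
rewrite le_eqVlt => /predU1P[<-|y0].
  by rewrite set_itvoc0 integral_set0 oppr0 expR0 subrr.
have mE (D : set R) : measurable D -> measurable_fun D (fun v : R => (expR (- v))%:E).
  by move=> _; apply/measurable_EFinP; apply: measurableT_comp => //; exact: measurable_funTS.
rewrite integral_itv_obnd_cbnd; last exact: mE.
have := @exponential_prob_itv0c R 1 y y0.
rewrite mulN1r -EFinB => <-.
rewrite /exponential_prob; apply: eq_integral => x /[!inE]/=; rewrite in_itv/= => /andP[x0 _].
by rewrite exponential_pdfE//= mul1r mulN1r.
Qed.

Lemma integrable_expRN_itv (R : realType) :
  lebesgue_measure.-integrable (`]0, +oo[ : set R) (fun v : R => (expR (- v))%:E).
Proof.
have h := integrable_exponential_pdf (ltr01 : 0 < (1 : R)).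
have {}h : lebesgue_measure.-integrable (`]0, +oo[%classic : set R)
    (EFin \o exponential_pdf 1).
  by apply: integrableS h => //; exact: measurable_itv.
apply: eq_integrable h => // x /[!inE]/=; rewrite in_itv/= andbT => x0.
by rewrite exponential_pdfE ?ltW//= mul1r mulN1r.
Qed.

(** On the dyadic piece ]2^(-n-1), 2^(-n)] the function is at most 2^((n+1) b) and the length is
    2^(-n-1), so the integral is dominated by a geometric series of ratio 2^(-(1 - b)). *)
Lemma integrable_powRN (R : realType) (b : R) : 0 < b -> b < 1 ->
  lebesgue_measure.-integrable (`]0, 1] : set R) (fun v : R => (v `^ (- b))%:E).
Proof.
move=> b0 b1.
have mf : measurable_fun (`]0, 1] : set R) (fun v : R => v `^ (- b)).
  by apply: measurable_funTS; exact: measurable_powR.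
apply/integrableP; split; first exact/measurable_EFinP.
under eq_integral do rewrite gee0_abs ?lee_fin ?powR_ge0//.
pose I n : set R := `]2^-1 ^+ n.+1, 2^-1 ^+ n]%classic.
have half0 : 0 < (2^-1 : R) by rewrite invr_gt0.
have IE : (`]0, 1]%classic : set R) = \bigcup_n I n.
  apply/seteqP; split => [x /=|x [n _]]; rewrite /I/= !in_itv/= => /andP[x0 x1].
    have [|n [nl nr]] := @dyadic_bracket _ x^-1; first by rewrite invf_ge1.
    exists n => //; rewrite /I/= in_itv/= !exprVn.
    by rewrite -[x]invrK ltf_pV2 ?lef_pV2 ?posrE ?exprn_gt0 ?invr_gt0// nr nl.
  by rewrite (lt_trans _ x0) ?exprn_gt0//= (le_trans x1)// exprn_ile1 ?ltW// invf_lt1// ltr1n.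
have mI n : measurable (I n) by exact: measurable_itv.
have tI : trivIset setT I.
  apply/trivIsetP => m n _ _; wlog mn : m n / (m < n)%N.
    move=> H mn; have [h|h] := ltnP m n; first exact: H.
    by rewrite setIC H 1?eq_sym// ltn_neqAle eq_sym mn h.
  move=> _; apply/seteqP; split => // x []; rewrite /I/= !in_itv/= => /andP[h1 _] /andP[_ h2].
  have := lt_le_trans h1 h2; rewrite ltNge => /negP; apply.
  by rewrite ler_wiXn2l// ?ltW// invf_lt1// ltr1n.
rewrite IE ge0_integral_bigcup//=; last 2 first.
  by rewrite -IE; exact/measurable_EFinP.
  by move=> x _; rewrite lee_fin powR_ge0.
pose dl : R := (1 - b) * ln 2.
have dl0 : 0 < dl by rewrite mulr_gt0 ?subr_gt0// ln_gt0// ltr1n.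
apply: (@le_lt_trans _ _ (\sum_(0 <= n <oo) (2 * expR (- (n.+1%:R * dl)))%:E)%E).
  apply: lee_nneseries => n _.
    by move=> _; apply: integral_ge0 => x _; rewrite lee_fin powR_ge0.
  apply: (@le_trans _ _ (\int[lebesgue_measure]_(x in I n) (((2^-1 ^+ n.+1) `^ (- b))%:E))%E).
    apply: ge0_le_integral => //.
    - exact: measurable_itv.
    - by move=> x _; rewrite lee_fin powR_ge0.
    - apply/measurable_EFinP; apply: measurable_funS mf => //.
      by rewrite IE; exact: bigcup_sup.
    - move=> x; rewrite /I/= in_itv/= => /andP[x0 _]; rewrite lee_fin !powRN.
      have h0 : 0 < (2^-1 : R) ^+ n.+1 by rewrite exprn_gt0.
      rewrite lef_pV2 ?posrE ?powR_gt0// ?(lt_trans h0)//.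
      by apply: ge0_ler_powR; rewrite ?nnegrE ?ltW// (lt_trans h0).
  rewrite /I integral_cst/=; last exact: measurable_itv.
  rewrite lebesgue_measure_itv/= lte_fin.
  have -> : (2^-1 : R) ^+ n.+1 < 2^-1 ^+ n.
    by rewrite exprS gtr_pMl ?exprn_gt0// invf_lt1// ltr1n.
  rewrite -EFinB -EFinM lee_fin.
  have E (m : nat) : (2^-1 : R) ^+ m = expR (- (m%:R * ln 2)).
    by rewrite -mulrN expRM_natl expRN lnK// posrE.
  have -> : (2^-1 : R) ^+ n - 2^-1 ^+ n.+1 = 2^-1 ^+ n.+1 by rewrite exprS; field.
  rewrite E /powR gt_eqF ?expR_gt0// expRK -expRD -mulrN.
  rewrite [X in expR X <= _](_ : _ = - (n.+1%:R * dl)); last by rewrite /dl; ring.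
  by rewrite ler_peMl ?expR_ge0// ler1n.
exact: nneseries_expR_lty.
Qed.

(** This is the shape of both dominating functions for alpha < 1: a power singularity at 0 and
    exponential decay at infinity. *)
Lemma integrable_powRN_expRN (R : realType) (b : R) : 0 < b -> b < 1 ->
  lebesgue_measure.-integrable (`]0, +oo[%classic : set R)
    (fun v : R => (expR (- v) + v `^ (- b) * \1_(`]0, 1]%classic : set R) v)%:E).
Proof.
move=> b0 b1; rewrite (_ : (fun v => _) = (fun v : R => (expR (- v))%:E) \+
    (fun v : R => (v `^ (- b) * \1_(`]0, 1]%classic : set R) v)%:E))%E//.
apply: integrableD => //; first exact: integrable_expRN_itv.
apply: (integrableS measurableT) => //.
rewrite (_ : (fun v => _) = ((fun v : R => (v `^ (- b))%:E) \_ (`]0, 1]%classic : set R))).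
  by apply/(integrable_mkcond _ _).1; [exact: measurable_itv|exact: integrable_powRN].
apply/funext => v; rewrite patchE indicE; case: ifPn => _.
  by rewrite mulr1.
by rewrite mulr0.
Qed.

(** Tonelli applied to 1 - e^(-s X), the integral of e^(-v) over 0 < v < s X. *)
Lemma one_sub_laplace d (T : measurableType d) (R : realType)
    (P : probability T R) (X : T -> R) (s : R) :
  measurable_fun setT X -> (forall w, 0 <= X w) -> 0 < s ->
  ((1 - laplace P X s)%:E =
   \int[lebesgue_measure]_(v in `]0%R, +oo[) (expR (- v) * survival P X (v / s))%:E)%E.
Proof.
move=> mX X0 s0.
have iL := integrable_expRN P mX X0 (ltW s0).
have Ls : (\int[P]_w (expR (- s * X w))%:E = (laplace P X s)%:E)%E.
  by rewrite /laplace /Rintegral fineK//; exact: integrable_fin_num.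
pose A : set (T * measurableTypeR R) := [set p | 0 < p.2 /\ p.2 < s * X p.1].
have mA : measurable A.
  pose g1 (p : T * measurableTypeR R) := 0 < p.2.
  pose g2 (p : T * measurableTypeR R) := p.2 < s * X p.1.
  rewrite [X in measurable X](_ : _ = g1 @^-1` [set true] `&` g2 @^-1` [set true])//.
  apply: measurableI.
  - have : measurable_fun setT g1 by exact: measurable_fun_ltr.
    by move=> /(_ measurableT [set true]); rewrite setTI; exact.
  - have : measurable_fun setT g2.
      apply: measurable_fun_ltr => //; apply: measurable_funM => //.
      exact: measurableT_comp.
    by move=> /(_ measurableT [set true]); rewrite setTI; exact.
pose f (p : T * measurableTypeR R) : \bar R := (expR (- p.2) * \1_A p)%:E.
have f0 p : (0 <= f p)%E by rewrite lee_fin mulr_ge0 ?expR_ge0// indicE.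
have mf : measurable_fun setT f.
  apply/measurable_EFinP; apply: measurable_funM; last exact: measurable_indic.
  by apply: measurableT_comp => //; exact: measurableT_comp.
transitivity (\int[P]_w \int[lebesgue_measure]_v f (w, v))%E.
  transitivity (\int[P]_w (1 - expR (- s * X w))%:E)%E.
    under eq_integral do rewrite EFinB.
    rewrite integralB_EFin//; last exact: finite_measure_integrable_cst.
    by rewrite Ls integral_cst//= probability_setT mul1e.
  apply: eq_integral => w _; rewrite mulNr -integral_expRN; last by rewrite mulr_ge0// ltW.
  rewrite -integral_itv_bndo_bndc; last first.
    by apply/measurable_EFinP; apply: measurableT_comp => //; exact: measurable_funTS.
  rewrite integral_mkcond; apply: eq_integral => v _.
  rewrite patchE /f /= indicE; case: ifPn => h.
    move: h; rewrite inE/= in_itv/= => /andP[v0 vX].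
    by rewrite mem_set ?mulr1.
  rewrite memNset ?mulr0// => -[/= v0 vX]; move/negP : h; apply.
  by rewrite inE/= in_itv/= v0 vX.
rewrite fubini_tonelli//.
rewrite [RHS]integral_mkcond; apply: eq_integral => v _.
rewrite patchE; case: ifPn => h; last first.
  apply: integral0_eq => w _; rewrite /f/= indicE memNset ?mulr0// => -[/= v0 _].
  by move/negP : h; apply; rewrite inE/= in_itv/= v0.
move: h; rewrite inE/= in_itv/= andbT => v0.
rewrite EFinM survivalE//.
rewrite -[X in (_ * P X)%E]setIT -integral_indic//; last exact: measurable_gt.
rewrite -ge0_integralZl_EFin ?expR_ge0//; last first.
  by apply/measurable_EFinP; apply: measurable_indic; exact: measurable_gt.
apply: eq_integral => w _; rewrite /f/= -EFinM; congr EFin.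
rewrite !indicE; congr (_ * (nat_of_bool _)%:R).
apply/idP/idP; rewrite !inE/= ltr_pdivrMr// mulrC; [by case|by []].
Qed.

(** The exponent b lies above alpha, for the Potter bound, and below 1, for integrability at 0. If x
    >= 1 monotonicity suffices; if x t >= t0 Potter applies between x t and t. If x t < t0, the
    numerator is at most 1 and Potter between t0 and t bounds 1 / F(t) by a multiple of (t / t0)^b,
    where t / t0 < 1 / x. *)
Lemma survival_ratio_le (R : realType) (F : R -> R) (alpha : R) :
  {homo F : s t / s <= t >-> t <= s} -> (forall t, 0 < F t) -> (forall t, F t <= 1) ->
  0 < alpha -> alpha < 1 -> F (2 * t) / F t @[t --> +oo] --> 2 `^ (- alpha) ->
  exists b C t0 : R, [/\ 0 < b, b < 1, 0 < C, 0 < t0 &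
  forall x t : R, 0 < x -> t0 <= t -> F (x * t) / F t <= C * (1 + x `^ (- b))].
Proof.
move=> F_ni F_gt0 F1 a0 a1 FRV; pose b := (alpha + 1) / 2.
have ab : alpha < b by rewrite /b; lra.
have b0 : 0 < b by exact: lt_trans ab.
have b1 : b < 1 by rewrite /b; lra.
have [t0 t00 H] := potter_lower F_ni F_gt0 FRV a0 ab.
pose C := 2 `^ b / F t0.
have p2 : 1 <= (2 : R) `^ b by rewrite -[leLHS](powRr0 (2 : R)); apply: ler_powR; rewrite ?ler1n// ltW.
have C2 : 2 `^ b <= C.
  by rewrite /C ler_pdivlMr// ler_piMr// powR_ge0.
have C0 : 0 < C by rewrite (lt_le_trans _ C2)// powR_gt0.
have C1 : 1 <= C by exact: le_trans C2.
exists b, C, t0; split => // x t x0 tt0.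
have t_gt0 : 0 < t by exact: lt_le_trans tt0.
have xb : 0 < x `^ (- b) by rewrite powR_gt0.
rewrite ler_pdivrMr//.
have [x1|x1] := leP 1 x.
  apply: (@le_trans _ _ (F t)); first by apply: F_ni; rewrite ler_peMl// ltW.
  by rewrite ler_peMl ?(ltW (F_gt0 _))//; nra.
have xE : t / (x * t) = x^-1 by field; rewrite !gt_eqF.
have [xt|xt] := leP t0 (x * t).
  have := H _ _ xt (_ : x * t <= t); rewrite ler_piMl ?(ltW x1) ?(ltW t_gt0)// => /(_ isT).
  rewrite xE -powR_inv1 ?(ltW x0)// -powRrM mulN1r => /le_trans; apply.
  rewrite ler_pM2r// ler_pM ?powR_ge0//; lra.
have := H _ _ (lexx t0) tt0 => Ft.
apply: (@le_trans _ _ (C * x `^ (- b) * F t)); last first.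
  by rewrite ler_pM2r// ler_pM2l// lerDr.
apply: (le_trans (F1 _)).
rewrite [leRHS](_ : _ = 2 `^ b * x `^ (- b) * F t / F t0); last by rewrite /C; ring.
rewrite ler_pdivlMr// mul1r (le_trans Ft)// ler_pM2r// ler_pM2l ?powR_gt0//.
have -> : x `^ (- b) = x^-1 `^ b by rewrite -powR_inv1 ?ltW// -powRrM mulN1r.
apply: ge0_ler_powR; [exact: ltW| | |].
- by rewrite nnegrE divr_ge0// ltW.
- by rewrite nnegrE invr_ge0 ltW.
- by rewrite ler_pdivrMr// ler_pdivlMl// ltW.
Qed.

(** The ratio is the integral of e^(-v) F(v t / z) / F(t), whose integrand tends to e^(-v) (v /
    z)^(-alpha); the limit integrates to Gamma(1 - alpha) z^alpha. *)
Lemma laplace_asymptotics d (T : measurableType d) (R : realType) (P : probability T R)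
    (X : T -> R) (alpha z : R) :
  measurable_fun setT X -> (forall w, 0 <= X w) -> 0 < alpha -> alpha < 1 ->
  (forall t, 0 < survival P X t) ->
  (forall c, 0 < c -> survival P X (c * t) / survival P X t @[t --> +oo] --> c `^ (- alpha)) ->
  0 < z ->
  (1 - laplace P X (z / t)) / survival P X t @[t --> +oo] --> Gamma (1 - alpha) * z `^ alpha.
Proof.
move=> mX X0 a0 a1 F0 FRV z0; set F := survival P X.
have F_ni : {homo F : s t / s <= t >-> t <= s} by exact: survival_ni.
have [b [C [t0 [b0 b1 C0 t00 HC]]]] := survival_ratio_le F_ni F0
  (survival_le1 P mX) a0 a1 (FRV 2 (ltr0n _ 2)).
apply/cvg_pinftyP => u uoo.
have [N _ HN] : \forall n \near \oo, t0 <= u n by move/cvgryPge : uoo; exact.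
(* After the shift every term of the sequence is at least [t0], so the domination holds for all
   n. *)
rewrite -(cvg_shiftn N) /=.
pose un n := u (n + N)%N.
have unt n : t0 <= un n by apply: HN => /=; rewrite leq_addl.
have un0 n : 0 < un n by exact: lt_le_trans (unt n).
have unoo : un n @[n --> \oo] --> +oo by rewrite /un; rewrite (cvg_shiftn N u).
pose f_ n (v : R) : \bar R := (expR (- v) * (F (v / z * un n) / F (un n)))%:E.
pose f (v : R) : \bar R := (expR (- v) * (v / z) `^ (- alpha))%:E.
pose h (v : R) : \bar R := (expR (- v) + v `^ (- b) * \1_(`]0, 1]%classic : set R) v)%:E.
pose K := C * (1 + z `^ b).
have zb : 0 < z `^ b by rewrite powR_gt0.
have K0 : 0 < K by rewrite /K mulr_gt0// addr_gt0.
have mD : measurable (`]0, +oo[%classic : set R) by exact: measurable_itv.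
have mF : measurable_fun setT F by exact: nonincreasing_measurable.
have mexp : measurable_fun setT (fun v : R => expR (- v)).
  by apply: measurableT_comp => //; exact: measurableT_comp.
have mf_ n : measurable_fun (`]0, +oo[%classic : set R) (f_ n).
  apply: measurable_funTS; apply/measurable_EFinP; apply: measurable_funM => //.
  apply: measurable_funM => //; apply: measurableT_comp => //.
  by apply: measurable_funM => //; exact: measurable_funM.
have mf : measurable_fun (`]0, +oo[%classic : set R) f.
  apply: measurable_funTS; apply/measurable_EFinP; apply: measurable_funM => //.
  by apply: (measurableT_comp (measurable_powR _)); exact: measurable_funM.
have ff v : `]0, +oo[%classic v -> f_ n v @[n --> \oo] --> f v.
  rewrite /= in_itv/= andbT => v0; apply: cvg_EFin; first exact: nearW.
  apply: cvgM; first exact: cvg_cst.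
  exact: ((cvg_pinftyP _ _).1 (FRV (v / z) (divr_gt0 v0 z0)) un unoo).
have fh n v : `]0, +oo[%classic v -> (`|f_ n v| <= K%:E * h v)%E.
  move=> vD; have v0 : 0 < v by move: vD; rewrite /= in_itv/= andbT.
  rewrite gee0_abs; last first.
    by rewrite lee_fin mulr_ge0 ?expR_ge0 ?divr_ge0 ?(ltW (F0 _)).
  rewrite lee_fin.
  have vz : 0 < v / z by exact: divr_gt0.
  have e1 : expR (- v) <= 1 by rewrite expR_le1 oppr_le0 ltW.
  have e0 := expR_gt0 (- v).
  have vb : 0 < v `^ (- b) by rewrite powR_gt0.
  have := HC (v / z) (un n) vz (unt n).
  have -> : (v / z) `^ (- b) = z `^ b * v `^ (- b).
    rewrite powRM ?invr_ge0 ?(ltW v0) ?(ltW z0)// mulrC; congr (_ * _).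
    by rewrite -powR_inv1 ?(ltW z0)// -powRrM mulrNN mul1r.
  set r := F _ / F _ => hr.
  (* For v <= 1 the factor e^(-v) is at most 1, for v > 1 the factor v^(-b) is. *)
  have key : expR (- v) * v `^ (- b) <= expR (- v) + v `^ (- b) * \1_(`]0, 1]%classic : set R) v.
    rewrite indicE; have [v1|v1] := leP v 1.
      by rewrite mem_set ?mulr1/= ?in_itv/= ?v0//; nra.
    rewrite memNset/= ?in_itv/= ?v0 ?(leNgt v) ?v1// mulr0 addr0 ler_piMr ?(ltW e0)//.
    rewrite powRN invf_le1 ?powR_gt0// -[leLHS](powRr0 v); apply: ler_powR; exact: ltW.
  have key2 : expR (- v) <= expR (- v) + v `^ (- b) * \1_(`]0, 1]%classic : set R) v.
    by rewrite lerDl mulr_ge0 ?powR_ge0// indicE.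
  move: key key2; set S := _ + v `^ _ * _ => key key2.
  apply: (@le_trans _ _ (expR (- v) * (C * (1 + z `^ b * v `^ (- b))))).
    by rewrite ler_pM2l.
  rewrite [leLHS](_ : _ = C * (expR (- v) + z `^ b * (expR (- v) * v `^ (- b)))); last ring.
  by rewrite /K -mulrA ler_pM2l// mulrDl mul1r lerD// ler_pM2l.
have ih : lebesgue_measure.-integrable (`]0, +oo[%classic : set R) h.
  exact: integrable_powRN_expRN.
have iKh : lebesgue_measure.-integrable (`]0, +oo[%classic : set R) (fun v => K%:E * h v)%E.
  exact: integrableZl.
have [iff _ cvgf] : [/\ lebesgue_measure.-integrable (`]0, +oo[%classic : set R) f, True &
    (\int[lebesgue_measure]_(v in `]0%R, +oo[) f_ n v)%E @[n --> \oo] -->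
    (\int[lebesgue_measure]_(v in `]0%R, +oo[) f v)%E].
  have [] := dominated_convergence (mu := @lebesgue_measure R) (f_ := f_) (f := f)
    (D := `]0, +oo[%classic) mD mf_ mf _ iKh _.
  - by apply: aeW => v; exact: ff.
  - by apply: aeW => v n; exact: fh.
  - by [].
have intf_ n : (\int[lebesgue_measure]_(v in `]0%R, +oo[) f_ n v)%E =
    ((1 - laplace P X (z / un n)) / F (un n))%:E.
  rewrite EFinM one_sub_laplace ?divr_gt0// muleC -ge0_integralZl_EFin//.
  - apply: eq_integral => v _; rewrite /f_ -EFinM; congr EFin.
    have -> : v / (z / un n) = v / z * un n by rewrite invf_div mulrA mulrAC.
    by rewrite [RHS]mulrC mulrA.
  - by move=> v _; rewrite lee_fin mulr_ge0 ?expR_ge0// survival_ge0.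
  - apply: measurable_funTS; apply/measurable_EFinP; apply: measurable_funM => //.
    by apply: measurableT_comp => //; exact: measurable_funM.
  - by rewrite invr_ge0 ltW// F0.
have intf : (\int[lebesgue_measure]_(v in `]0%R, +oo[) f v)%E =
    (Gamma (1 - alpha) * z `^ alpha)%:E.
  have za : 0 < z `^ alpha by rewrite powR_gt0.
  pose g (v : R) : \bar R := (v `^ (1 - alpha - 1) * expR (- v))%:E.
  have fg v : v \in (`]0, +oo[%classic : set R) -> f v = ((z `^ alpha)%:E * g v)%E.
    rewrite inE/= in_itv/= andbT => v0; rewrite /f /g -EFinM; congr EFin.
    have -> : 1 - alpha - 1 = - alpha by ring.
    rewrite powRM ?invr_ge0 ?(ltW v0) ?(ltW z0)//.
    rewrite -(powR_inv1 (ltW z0)) -powRrM mulrNN mul1r; ring.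
  have ig : lebesgue_measure.-integrable (`]0, +oo[%classic : set R) g.
    have : lebesgue_measure.-integrable (`]0, +oo[%classic : set R)
        (fun v => ((z `^ alpha)^-1)%:E * f v)%E by exact: integrableZl.
    apply: eq_integrable => // v vD; rewrite fg// muleA -EFinM mulVf ?gt_eqF//.
    by rewrite ?mul1e ?mul1r.
  transitivity (\int[lebesgue_measure]_(v in `]0%R, +oo[) ((z `^ alpha)%:E * g v))%E.
    by apply: eq_integral => v; exact: fg.
  rewrite integralZl//.
  rewrite /Gamma /Rintegral mulrC EFinM fineK//.
  exact: integrable_fin_num.
have -> : (fun n => (1 - laplace P X (z / u (n + N)%N)) / F (u (n + N)%N)) =
    fine \o (fun n => \int[lebesgue_measure]_(v in `]0%R, +oo[) f_ n v)%E.
  by apply/funext => n /=; rewrite intf_.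
by apply: fine_cvg; move: cvgf; rewrite intf.
Qed.

(** * Tails of sums and limits at points without atoms *)

Lemma cvg_survivaly0 d (T : measurableType d) (R : realType) (P : probability T R)
    (X : T -> R) : measurable_fun setT X -> survival P X t @[t --> +oo] --> (0 : R).
Proof.
move=> mX; pose X' : {mfun T >-> R} := HB.pack X (isMeasurableFun.Build _ _ _ _ _ mX).
have -> : survival P X = fine \o ccdf (X' : {RV P >-> R}).
  by apply/funext => t; rewrite /survival preimage_gt.
exact/fine_cvg/cvg_ccdfy0.
Qed.

Lemma survival_partial_sum_ge d (T : measurableType d) (R : realType)
    (P : probability T R) (X : nat -> {RV P >-> R}) n (t : R) :
  iid P X -> (forall n w, 0 <= X n w) ->
  1 - expR (- (n%:R * survival P (X 0%N) t)) <= survival P (partial_sum X n) t.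
Proof.
move=> iX X0; set F := survival P (X 0%N) t.
have mX0 := measurable_funPT (X 0%N).
have mS := partial_sum_measurable X n.
apply: (le_trans (one_sub_expRN_le n (survival_ge0 _ _ _) (survival_le1 P mX0 t))).
rewrite lerBlDl -lerBlDr.
have PC (Y : T -> R) : measurable_fun setT Y ->
    (\int[P]_w (\1_[set x : R | x <= t] (Y w))%:E)%E = (1 - survival P Y t)%:E.
  move=> mY; rewrite EFinB survivalE// -probability_setC; last exact: measurable_gt.
  have -> : ~` [set w | t < Y w] = Y @^-1` [set x | x <= t].
    by apply/seteqP; split => w /=; [move/negP; rewrite -leNgt|rewrite leNgt => /negP].
  rewrite -[in RHS](setIT (Y @^-1` _)) -integral_indic//.
  by rewrite -[X in measurable X]setTI; apply: mY => //; rewrite -set_itvNyc; exact: measurable_itv.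
rewrite -lee_fin EFin_expe -(PC _ mX0) -(PC _ mS).
have mI : measurable_fun setT (\1_[set x : R | x <= t] : R -> R).
  by apply: measurable_indic; rewrite -set_itvNyc; exact: measurable_itv.
rewrite -(integral_prod_iid (f := \1_[set x : R | x <= t]) n iX)//; last first.
  by rewrite (PC _ mX0) ltry.
apply: ge0_le_integral => //.
- by apply/measurable_EFinP; apply: measurableT_comp.
- apply/measurable_EFinP; apply: measurable_prod => k _; apply: measurableT_comp => //.
- move=> w _; rewrite lee_fin.
  have I1 y : y <= t -> \1_[set x : R | x <= t] y = 1 :> R.
    by move=> yt; rewrite indicE mem_set.
  have [St|St] := leP (partial_sum X n w) t; last first.
    rewrite [leLHS]indicE memNset; last by apply/negP; rewrite -ltNge.
    by apply: prodr_ge0 => k _; rewrite indicE.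
  rewrite I1// big_seq big1// => k.
  rewrite mem_index_iota => /andP[k1 kn]; apply: I1.
  apply: le_trans St; rewrite /partial_sum (bigD1_seq k) ?iota_uniq ?mem_index_iota ?k1//=.
  by rewrite lerDl sumr_ge0.
Qed.

(** Squeezed by exp(-n a / (1 - a)) <= (1 - a)^n <= exp(-n a), once a < 1. *)
Lemma cvg_one_sub_exprn (R : realType) (a : nat -> R) (n : nat -> nat) (c : R) :
  (forall k, 0 <= a k) ->
  a k @[k --> \oo] --> (0 : R) -> (n k)%:R * a k @[k --> \oo] --> c ->
  (1 - a k) ^+ n k @[k --> \oo] --> expR (- c).
Proof.
move=> a0 ca cna.
apply: (@squeeze_cvgr _ _ _ _ (fun k => expR (- ((n k)%:R * a k * (1 - a k)^-1)))
   (fun k => expR (- ((n k)%:R * a k)))).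
- near=> k.
  have ak1 : a k < 1 by near: k; exact: cvgr_lt ca _ ltr01.
  have d0 : 0 < 1 - a k by rewrite subr_gt0.
  apply/andP; split; rewrite -?mulrA -mulrN expRM_natl lerXn2r ?nnegrE ?expR_ge0 ?(ltW d0)//.
    rewrite expRN -[leRHS]invrK lef_pV2 ?posrE ?expR_gt0 ?invr_gt0//.
    rewrite (le_trans _ (expR_ge1Dx _))//.
    by rewrite [leRHS](_ : _ = (1 - a k)^-1)//; field; rewrite gt_eqF.
  exact: expR_ge1Dx.
- have h : - ((n k)%:R * a k * (1 - a k)^-1) @[k --> \oo] --> - c.
    apply: cvgN; rewrite -[X in _ --> X]mulr1; apply: cvgM => //.
    rewrite -[X in _ --> X]invr1; apply: cvgV; first by rewrite oner_neq0.
    by rewrite -[X in _ --> X]subr0; apply: cvgB => //; exact: cvg_cst.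
  exact: (cvg_comp _ _ h (@continuous_expR R (- c))).
- have h : - ((n k)%:R * a k) @[k --> \oo] --> - c by exact: cvgN.
  exact: (cvg_comp _ _ h (@continuous_expR R (- c))).
Unshelve. all: by end_near. Qed.

(** Right continuity always holds; left continuity fails only by the mass at [c], which is zero
    here. *)
Lemma survival_continuous_at d (T : measurableType d) (R : realType) (P : probability T R)
    (X : T -> R) (c e : R) : measurable_fun setT X -> P [set w | X w = c] = 0%E -> 0 < e ->
  0 < c ->
  exists dl, [/\ 0 < dl, dl < c, survival P X (c - dl) <= survival P X c + e &
    survival P X c <= survival P X (c + dl) + e].
Proof.
move=> mX Pc e0 c0.
pose X' : {mfun T >-> R} := HB.pack X (isMeasurableFun.Build _ _ _ _ _ mX).
have mc : measurable [set w | X w = c].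
  rewrite [X in measurable X](_ : _ = X' @^-1` [set c])//; exact: measurable_funPTI.
(* The denominators n + 2 keep the step strictly below [c]. *)
have inv0 : (c / n.+2%:R) @[n --> \oo] --> (0 : R).
  rewrite -[X in _ --> X](mulr0 c); apply: cvgM; first exact: cvg_cst.
  have := @cvg_harmonic R; rewrite -(cvg_shiftn 1) => h.
  rewrite (_ : (fun _ => _) = (fun n => harmonic (n + 1)%N))//.
  by apply/funext => n; rewrite addn1.
have R1 : survival P X (c + c / n.+2%:R) @[n --> \oo] --> survival P X c.
  have E : ccdf (X' : {RV P >-> R}) = EFin \o survival P X.
    by apply/funext => t; rewrite /= survivalE// preimage_gt.
  have := @ccdf_right_continuous _ _ _ P X' c; rewrite E.
  move/fine_cvgP => -[_] h; apply: ((cvg_at_rightP _ _ _).1 h); split.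
    by move=> n; rewrite ltrDl divr_gt0.
  by rewrite -[X in _ --> X]addr0; apply: cvgD => //; exact: cvg_cst.
have L1 : survival P X (c - c / n.+2%:R) @[n --> \oo] --> survival P X c.
  have -> : survival P X c = fine (P (\bigcap_n [set w | c - c / n.+2%:R < X w])).
    rewrite /survival; have -> : \bigcap_n [set w | c - c / n.+2%:R < X w]
      = [set w | c < X w] `|` [set w | X w = c].
      apply/seteqP; split=> w /=.
        move=> h; case: (ltgtP c (X w)) => [Xc|Xc|Xc]; [by left| |by right].
        exfalso.
        have : \forall n \near \oo, c / n.+2%:R < c - X w.
          by apply: (cvgr_lt _ inv0); rewrite subr_gt0.
        move=> [N _ /(_ N (leqnn _))]/= q; have := h N I.
        by rewrite /= ltrBlDr -ltrBlDl => /lt_trans/(_ q); rewrite ltxx.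
      move=> h n _ /=; case: h => [cX|->].
        by apply: lt_trans cX; rewrite gtrBl divr_gt0.
      by rewrite gtrBl divr_gt0.
    have -> : (P ([set w | (c < X w)%R] `|` [set w | X w = c]) =
        P [set w | (c < X w)%R] + P [set w | X w = c])%E.
      rewrite measureU//; first exact: measurable_gt.
      by apply/seteqP; split => // w [/= h1 h2]; move: h1; rewrite h2 ltxx.
    by rewrite Pc adde0.
  apply: fine_cvg; rewrite fineK; last first.
    apply: fin_num_measure; apply: bigcap_measurableType => n _; exact: measurable_gt.
  apply: nonincreasing_cvg_mu => //.
  - by rewrite (le_lt_trans (probability_le1 _ _))// ?ltry//; exact: measurable_gt.
  - by move=> n; exact: measurable_gt.
  - by apply: bigcap_measurableType => n _; exact: measurable_gt.
  - move=> m n mn; apply/subsetPset => w /=; apply: le_lt_trans.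
    by rewrite lerD2l lerN2 ler_pM2l// lef_pV2 ?posrE// ler_nat.
have : \forall n \near \oo, survival P X (c - c / n.+2%:R) <= survival P X c + e /\
     survival P X c <= survival P X (c + c / n.+2%:R) + e.
  near=> n; split.
    by near: n; apply: (cvgr_le _ L1); rewrite ltrDl.
  rewrite -lerBlDr; near: n; apply: (cvgr_ge _ R1); by rewrite ltrBlDr ltrDl.
move=> [N _ /(_ N (leqnn _))] [h1 h2]; exists (c / N.+2%:R); split=> //.
  by rewrite divr_gt0.
by rewrite ltr_pdivrMr// ltr_pMr// ltr1n.
Unshelve. all: by end_near. Qed.

(** The gap of [laplace_survival_cvg] is placed on either side of 1 and closed by continuity of the
    limit tail there. The upper estimate is stated at 1 - dl so that it also covers the closed event
    Y k >= 1. *)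
Lemma laplace_survival_at d d' (T : measurableType d) (T' : measurableType d')
    (R : realType) (P : probability T R) (P' : probability T' R)
    (Y : nat -> T -> R) (Z : T' -> R) (e : R) :
  (forall k, measurable_fun setT (Y k)) -> (forall k w, 0 <= Y k w) ->
  measurable_fun setT Z -> (forall w, 0 <= Z w) ->
  (forall z, 0 <= z -> laplace P (Y k) z @[k --> \oo] --> laplace P' Z z) ->
  P' [set w | Z w = 1] = 0%E -> 0 < e ->
  exists2 dl, 0 < dl & \forall k \near \oo,
    survival P (Y k) (1 - dl) <= survival P' Z 1 + e /\
    survival P' Z 1 <= survival P (Y k) 1 + e.
Proof.
move=> mY Y0 mZ Z0 YZ Z1 e0; have e2 : 0 < e / 2 by rewrite divr_gt0.
have [dl [dl0 dl1 h1 h2]] := survival_continuous_at mZ Z1 e2 ltr01.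
have dl2 : 0 < dl / 2 by rewrite divr_gt0.
exists (dl / 2) => //; near=> k.
have [] : survival P (Y k) (1 - dl / 2) <= survival P' Z (1 - dl) + e / 2 /\
          survival P' Z (1 - dl / 2) <= survival P (Y k) (1 - dl) + e / 2.
  by near: k; apply: laplace_survival_cvg => //; clear - dl0 dl1 dl2; lra.
have [] : survival P (Y k) (1 + dl) <= survival P' Z 1 + e / 2 /\
          survival P' Z (1 + dl) <= survival P (Y k) 1 + e / 2.
  by near: k; apply: laplace_survival_cvg => //; clear - dl0 dl1 dl2; lra.
by move=> _ h3 h4 _; clear - h1 h2 h3 h4; lra.
Unshelve. all: by end_near. Qed.

(** * The stable subordinator and its inverse *)

Section stable.
Context d (T : measurableType d) (R : realType) (Q : probability T R).
Variables (alpha : R) (W : R -> {RV Q >-> R}).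
Hypotheses (alpha_gt0 : 0 < alpha) (W_stable : stable_subordinator alpha W).

Lemma stable_ge0 t w : 0 <= t -> 0 <= W t w.
Proof.
move=> t0; case: W_stable => -[W0 Wnd _ _ _] _.
by rewrite -(W0 w) Wnd.
Qed.

Lemma laplace_stable t z : 0 <= t -> 0 <= z ->
  laplace Q (W t) z = expR (- (Gamma (1 - alpha) * t * z `^ alpha)).
Proof.
move=> t0 z0; have [_ /(_ t z t0 z0)] := W_stable.
have Wt0 w : 0 <= W t w by exact: stable_ge0.
have iz := integrable_expRN Q (measurable_funPT (W t)) Wt0 z0.
have fz : (\int[Q]_w (expR (- z * W t w))%:E)%E \is a fin_num.
  exact: integrable_fin_num.
rewrite unlock /laplace /Rintegral -(fineK fz) /=.
(* At a nonpositive argument [lne] is -oo, which the finite exponent excludes. *)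
set r := fine _; case: ifPn => // r0 [<-]; rewrite opprK lnK// posrE.
by rewrite ltNge.
Qed.

(** Self-similarity. It replaces the family W(x) by multiples of the single variable W(1), so that
    one countable set of atoms serves all x. *)
Lemma laplace_stable_scale x z : 0 < x -> 0 <= z ->
  laplace Q (fun w => x `^ alpha^-1 * W 1 w) z = laplace Q (W x) z.
Proof.
move=> x0 z0; have px := powR_ge0 x alpha^-1.
transitivity (laplace Q (W 1) (z * x `^ alpha^-1)).
  by apply: eq_Rintegral => w _; rewrite mulrA mulNr.
have zx : 0 <= z * x `^ alpha^-1 by rewrite mulr_ge0.
rewrite (laplace_stable ler01 zx) (laplace_stable (ltW x0) z0) mulr1.
rewrite powRM// -powRrM mulVf ?gt_eqF//.
by rewrite powRr1 ?(ltW x0)//; congr (expR (- _)); ring.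
Qed.

(** An atom r of W(1) spoils only x = r^(-alpha), and a law has countably many atoms. *)
Lemma stable_null_ae : {ae lebesgue_measure, forall x : R, 0 < x ->
  Q [set w | x `^ alpha^-1 * W 1 w = 1] = 0%E}.
Proof.
pose A := [set r | 0 < pmf (W 1) r].
have cA : countable A by exact: pmf_gt0_countable.
pose B := [set r `^ (- alpha) | r in A].
have cB : countable B by apply: (sub_countable (card_image_le _ _) cA).
exists B; split; [exact: countable_measurable|exact: countable_lebesgue_measure0|].
move=> x /= /not_implyP [x0 Qx]; exists ((x `^ alpha^-1)^-1); last first.
  by rewrite -powRN -powRrM mulrNN mulVf ?gt_eqF// powRr1// ltW.
have px : 0 < x `^ alpha^-1 by rewrite powR_gt0.
rewrite /A /= /pmf; rewrite fine_gt0//; apply/andP; split; last first.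
  by rewrite (le_lt_trans (probability_le1 _ _))// ltry.
rewrite lt0e measure_ge0 andbT; apply/eqP => h; apply: Qx; rewrite -h.
congr (Q _); apply/seteqP; split => w /=.
  by move=> pW; rewrite -[LHS](mulKf (lt0r_neq0 px)) pW mulr1.
by move=> ->; rewrite mulfV ?gt_eqF.
Qed.

(** The infimum is at most x iff W passes 1 before every x + 1/(n+1), which by monotonicity is a
    condition on W at these times. This also makes the event measurable. *)
Lemma inverse_processE x : 0 <= x -> [set w | (inverse_process W 1 w <= x%:E)%E] =
  \bigcap_n [set w | 1 < W (x + n.+1%:R^-1) w].
Proof.
move=> x0; case: W_stable => -[W0 Wnd _ _ _] _.
have n0 n : 0 < (n.+1%:R^-1 : R) by rewrite invr_gt0.
apply/seteqP; split => w /= h.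
  move=> n _ /=; have : (inverse_process W 1 w < (x + n.+1%:R^-1)%:E)%E.
    by rewrite (le_lt_trans h)// lte_fin ltrDl.
  move=> /ereal_inf_lt[_ [s [s0 Ws] <-]]; rewrite lte_fin => sx.
  by rewrite (lt_le_trans Ws)// Wnd// ltW.
apply/lee_addgt0Pr => e e0.
have [N _ HN] := near_infty_natSinv_lt (PosNum e0).
apply: (@le_trans _ _ (x + N.+1%:R^-1)%:E).
  by apply: ereal_inf_lbound; exists (x + N.+1%:R^-1) => //; split; [rewrite addr_ge0// ltW|exact: h].
by rewrite -EFinD lee_fin lerD2l ltW// HN//=.
Qed.

Lemma measurable_inverse_process x : 0 <= x ->
  measurable [set w | (inverse_process W 1 w <= x%:E)%E].
Proof.
move=> x0; rewrite inverse_processE//; apply: bigcap_measurableType => n _.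
exact/measurable_gt/measurable_funPT.
Qed.

(** The event contains {W(x) > 1} and, by right continuity of the paths, lies in {W(x) >= 1}. Both
    are compared with the rescaled W(1), which has the same Laplace transform as W(x) and no atom at
    1: [laplace_survival_at] is applied to a constant sequence. *)
Lemma inverse_process_survival x : 0 < x ->
  Q [set w | x `^ alpha^-1 * W 1 w = 1] = 0%E ->
  Q [set w | (inverse_process W 1 w <= x%:E)%E] =
  (survival Q (fun w => x `^ alpha^-1 * W 1 w) 1)%:E.
Proof.
move=> x0 Qx; pose Z w := x `^ alpha^-1 * W 1 w.
have mA := measurable_inverse_process (ltW x0).
have mW t : measurable_fun setT (W t) by exact: measurable_funPT.
have mZ : measurable_fun setT Z by apply: measurable_funM.
rewrite -[X in survival Q X]/Z.
have H e : 0 < e -> exists2 dl, 0 < dl &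
    survival Q (W x) (1 - dl) <= survival Q Z 1 + e /\
    survival Q Z 1 <= survival Q (W x) 1 + e.
  move=> e0; have [||||dl dl0 [N _ HN]] := @laplace_survival_at _ _ _ _ _ Q Q (fun=> W x) Z e _ _ mZ _ _ Qx e0.
  - by [].
  - by move=> k w; apply: stable_ge0; exact: ltW.
  - by move=> w; rewrite mulr_ge0 ?powR_ge0 ?stable_ge0.
  - by move=> z z0; rewrite laplace_stable_scale//; exact: cvg_cst.
  - by exists dl => //; exact: (HN N (leqnn _)).
have Afin : Q [set w | (inverse_process W 1 w <= x%:E)%E] \is a fin_num by rewrite fin_num_measure.
rewrite -(fineK Afin); congr EFin; apply/eqP; rewrite eq_le; apply/andP; split.
  apply/ler_addgt0Pr => e /H [dl dl0 [h _]]; apply: le_trans h.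
  rewrite -lee_fin fineK// survivalE// le_measure ?inE//; first exact: measurable_gt.
  rewrite inverse_processE ?(ltW x0)// => w /= h.
  suff : 1 <= W x w by apply: lt_le_trans; rewrite ltrBlDr ltrDl.
  have [[_ _ Wr _ _] _] := W_stable.
  have := (cvg_at_rightP _ _ _).1 (Wr w x (ltW x0)) (fun n => x + n.+1%:R^-1) _.
  move=> /(_ _)/cvgr_to_ge; apply; last by apply: nearW => n; rewrite ltW//; exact: h.
  split=> [n|]; first by rewrite ltrDl invr_gt0.
  by rewrite -[X in _ --> X]addr0; apply: cvgD; [exact: cvg_cst|exact: cvg_harmonic].
apply/ler_addgt0Pr => e /H [dl dl0 [_ h]]; apply: (le_trans h).
rewrite lerD2r -lee_fin survivalE// fineK// le_measure ?inE//; first exact: measurable_gt.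
rewrite inverse_processE ?(ltW x0)// => w /= h1 n _ /=.
have [[_ Wnd _ _ _] _] := W_stable.
by rewrite (lt_le_trans h1)// Wnd ?(ltW x0)// lerDl invr_ge0.
Qed.

End stable.

(** * The logarithm of P(min > t) as a series and as an integral *)

Lemma lne_min_ge1_partial_sum d d' (T : measurableType d) (T' : measurableType d')
    (R : realType) (P : probability T R) (P' : probability T' R)
    (xi : nat -> {RV P >-> R}) (hatS : nat -> {RV P' >-> R}) (t : R) :
  iid P xi -> (forall n w, 0 <= xi n w) ->
  independent P' [set n | (1 <= n)%N] hatS ->
  (forall n, (1 <= n)%N -> same_law P' P (hatS n) (partial_sum xi n)) ->
  (forall t, 0 < survival P (xi 0%N) t) ->
  (- lne (P' [set w | t%:E < min_ge1 hatS w]) =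
   \sum_(0 <= n <oo) (- ln (survival P (partial_sum xi n.+1) t))%:E)%E.
Proof.
move=> iX X0 indS lawS F0.
have hatE n s : survival P' (hatS n.+1) s = survival P (partial_sum xi n.+1) s.
  rewrite /survival !preimage_gt; congr fine; exact: lawS.
have mS n : measurable_fun setT (partial_sum xi n) by exact: partial_sum_measurable.
have p1 n s : 1 - expR (- (n.+1%:R * survival P (xi 0%N) s)) <=
    survival P (partial_sum xi n.+1) s by exact: survival_partial_sum_ge.
have e0 n s : 0 < 1 - expR (- (n.+1%:R * survival P (xi 0%N) s)).
  by rewrite subr_gt0 expR_lt1 oppr_lt0 mulr_gt0.
have p0 n s : 0 < survival P (partial_sum xi n.+1) s by exact: lt_le_trans (p1 n s).
(* Any level above t would do: the series at level t + 1 converges because -ln p_n is at most a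
   multiple of e^(-n F(t + 1)). *)
rewrite (@lne_min_ge1 _ _ _ _ _ t (t + 1))//.
- by apply: eq_eseriesr => n _; rewrite hatE.
- by rewrite ltrDl.
- by move=> n; rewrite hatE.
- set F := survival P (xi 0%N) (t + 1).
  have C0 : 0 <= (1 - expR (- F))^-1.
    by rewrite invr_ge0 subr_ge0 expR_le1 oppr_le0 ltW// F0.
  apply: le_lt_trans (nneseries_expR_lty (F0 (t + 1)) C0).
  apply: lee_nneseries => n _.
    by move=> _; rewrite lee_fin oppr_ge0 ln_le0// survival_le1//; exact: measurable_funPT.
  rewrite lee_fin hatE.
  apply: le_trans (ln_one_sub_expRN_le_expR (F0 (t + 1)) (_ : F <= n.+1%:R * F)).
    by rewrite lerN2 ler_ln ?posrE; [exact: p1|exact: e0|exact: p0].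
  by rewrite ler_peMl ?ler1n// ltW// F0.
Qed.

Lemma partial_sum_le (T : Type) (R : realType) (X : nat -> T -> R) (m n : nat) w :
  (forall n w, 0 <= X n w) -> (m <= n)%N -> partial_sum X m w <= partial_sum X n w.
Proof.
move=> X0 mn; rewrite /partial_sum [leRHS](@big_cat_nat _ _ _ m.+1)//= lerDl.
by apply: sumr_ge0.
Qed.

(** The integrand is constant, equal to [p n], on [n F, (n+1) F[. The argument is clamped at 0 in
    [g] so that [g] is monotone on the whole line, hence measurable. *)
Lemma nneseries_step_integral (R : realType) (p : nat -> R) (F : R) :
  0 < F -> (forall n, 0 <= p n) -> nonincreasing_seq p ->
  ((\sum_(0 <= n <oo) (p n)%:E) * F%:E =
   \int[lebesgue_measure]_(x in `]0%R, +oo[) (p (Num.truncn (x / F)))%:E)%E.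
Proof.
move=> F0 p0 pni; pose g (x : R) := p (Num.truncn (Num.max x 0 / F)).
have mg (D : set R) : measurable D -> measurable_fun D (fun x => (g x)%:E).
  move=> mD; apply: measurable_funTS; apply/measurable_EFinP.
  apply: nonincreasing_measurable => // x y xy; apply: pni.
  apply: le_truncn; rewrite ler_pM2r ?invr_gt0//.
  by rewrite ge_max !le_max xy lexx orbT.
transitivity (\int[lebesgue_measure]_(x in `]0%R, +oo[) (g x)%:E)%E; last first.
  apply: eq_integral => x; rewrite inE/= in_itv/= andbT => x0.
  by rewrite /g max_l// ltW.
rewrite integral_itv_obnd_cbnd; last exact: mg.
pose I n : set R := `[n%:R * F, n.+1%:R * F[%classic.
have IP n x : I n x -> Num.truncn (Num.max x 0 / F) = n /\ 0 <= x.
  rewrite /I/= in_itv/= => /andP[nx xn].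
  have x0 : 0 <= x by rewrite (le_trans _ nx)// mulr_ge0// ltW.
  split => //; apply: truncn_def; rewrite max_l//.
  by rewrite ler_pdivlMr// nx ltr_pdivrMr.
have IE : (`[0, +oo[%classic : set R) = \bigcup_n I n.
  apply/seteqP; split => [x /=|x [n _ /IP[_ x0]]].
    rewrite in_itv/= andbT => x0; exists (Num.truncn (x / F)) => //.
    rewrite /I/= in_itv/= -ler_pdivlMr// -ltr_pdivrMr//.
    by apply: truncn_itv; rewrite divr_ge0// ltW.
  by rewrite /= in_itv/= x0.
have mI n : measurable (I n) by exact: measurable_itv.
rewrite IE ge0_integral_bigcup//=; last 3 first.
- by apply: mg; apply: bigcup_measurable.
- by move=> x _; rewrite lee_fin p0.
- apply/trivIsetP => m n _ _ mn; apply/seteqP; split => // x [/IP[h1 _] /IP[h2 _]].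
  by move/eqP: mn; apply; rewrite -h1 -h2.
have E n : (\int[lebesgue_measure]_(x in I n) (g x)%:E = (p n)%:E * F%:E)%E.
  transitivity (\int[lebesgue_measure]_(x in I n) (p n)%:E)%E.
    by apply: eq_integral => x; rewrite inE => /IP[h _]; rewrite /g h.
  rewrite /I integral_cst/=; last exact: measurable_itv.
  rewrite lebesgue_measure_itv/= lte_fin ltr_pM2r// ltr_nat ltnSn -EFinB.
  by congr (_ * _%:E)%E; rewrite -mulrBl -natr1 addrAC subrr add0r mul1r.
under [RHS]eq_eseriesr do rewrite E.
rewrite muleC -nneseriesZl//; last by move=> n _; rewrite lee_fin p0.
by apply: eq_eseriesr => n _; rewrite muleC.
Qed.

(** * The case alpha < 1 *)

Section part_a.
Context d (T : measurableType d) (R : realType) (P : probability T R).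
Context d' (TW : measurableType d') (Q : probability TW R).
Variables (xi : nat -> {RV P >-> R}) (W : R -> {RV Q >-> R}) (alpha : R).
Hypotheses (iX : iid P xi) (X0 : forall n w, 0 <= xi n w).
Hypotheses (a0 : 0 < alpha) (a1 : alpha < 1).
Let F := survival P (xi 0%N).
Hypothesis F0 : forall t, 0 < F t.
Hypothesis FRV : forall c, 0 < c -> F (c * t) / F t @[t --> +oo] --> c `^ (- alpha).
Hypothesis W_stable : stable_subordinator alpha W.

Let mxi n : measurable_fun setT (xi n). Proof. exact: measurable_funPT. Qed.
Let mS n : measurable_fun setT (partial_sum xi n).
Proof. exact: partial_sum_measurable. Qed.

(** The added 1 makes x <= N F(u) <= x + F(u): N F(u) tends to x from above, and the bound 1 -
    e^(-x) holds for every u. *)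
Let N (u x : R) := (Num.truncn (x / F u)).+1.

(** The transform of the sum is (1 - a)^N with a = 1 - E exp(-z xi / u). Then a / F(u) tends to
    Gamma(1 - alpha) z^alpha and N F(u) to x, so N a tends to their product. *)
Lemma cvg_laplace_partial_sum (u : nat -> R) (x z : R) :
  u n @[n --> \oo] --> +oo -> 0 < x -> 0 <= z -> (forall k, 0 < u k) ->
  laplace P (fun w => partial_sum xi (N (u k) x) w / u k) z @[k --> \oo] -->
  expR (- (Gamma (1 - alpha) * x * z `^ alpha)).
Proof.
move=> uoo x0 z0 u0.
have lapE k : laplace P (fun w => partial_sum xi (N (u k) x) w / u k) z =
    (1 - (1 - laplace P (xi 0%N) (z / u k))) ^+ N (u k) x.
  rewrite subKr -(laplace_partial_sum _ iX)//; last by rewrite divr_ge0// ltW.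
  by apply: eq_Rintegral => w _; congr expR; ring.
under eq_cvg do rewrite lapE.
have lap1 k : laplace P (xi 0%N) (z / u k) <= 1.
  have z1 : 0 <= z / u k by rewrite divr_ge0// ltW.
  have -> : 1 = \int[P]_w (1 : R) by rewrite Rintegral_cst//= probability_setT mulr1.
  apply: le_Rintegral => //.
  - exact: (integrable_expRN P (mxi 0%N) (X0 0%N)).
  - exact: finite_measure_integrable_cst.
  - by move=> w _; rewrite expR_le1 mulNr oppr_le0 mulr_ge0.
have cF : F (u k) @[k --> \oo] --> (0 : R).
  by apply: ((cvg_pinftyP _ _).1 _) uoo; exact: cvg_survivaly0.
have ca : (1 - laplace P (xi 0%N) (z / u k)) / F (u k) @[k --> \oo] -->
    Gamma (1 - alpha) * z `^ alpha.
  move: z0; rewrite le_eqVlt => /predU1P[<-|z0]; last first.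
    have h := laplace_asymptotics (mxi 0%N) (X0 0%N) a0 a1 F0 FRV z0.
    exact: ((cvg_pinftyP _ _).1 h) u uoo.
  rewrite powR0 ?gt_eqF// mulr0.
  rewrite (_ : (fun _ => _) = cst 0); first exact: cvg_cst.
  apply/funext => k; rewrite mul0r /laplace.
  under eq_Rintegral do rewrite oppr0 mul0r expR0.
  by rewrite Rintegral_cst//= probability_setT mulr1 subrr mul0r.
have cn : (N (u k) x)%:R * F (u k) @[k --> \oo] --> x.
  apply: (@squeeze_cvgr _ _ _ _ (fun=> x) (fun k => x + F (u k))).
  - apply: nearW => k; have xF : 0 <= x / F (u k) by rewrite divr_ge0// ltW// F0.
    have /andP[h1 h2] := truncn_itv xF.
    rewrite -ler_pdivrMr ?F0// ltW//= -natr1 mulrDl mul1r lerD2r.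
    by rewrite -ler_pdivlMr ?F0.
  - exact: cvg_cst.
  - by rewrite -[X in _ --> X]addr0; apply: cvgD => //; exact: cvg_cst.
have FE k : 1 - laplace P (xi 0%N) (z / u k) =
    (1 - laplace P (xi 0%N) (z / u k)) / F (u k) * F (u k).
  by rewrite mulfVK// gt_eqF// F0.
apply: cvg_one_sub_exprn.
- by move=> k; rewrite subr_ge0.
- under eq_cvg do rewrite FE.
  have hh : (1 - laplace P (xi 0%N) (z / u k)) / F (u k) * F (u k) @[k --> \oo] -->
      Gamma (1 - alpha) * z `^ alpha * 0 by exact: cvgM.
  by rewrite mulr0 in hh.
- under eq_cvg do rewrite FE mulrCA.
  rewrite (_ : Gamma (1 - alpha) * x * z `^ alpha = Gamma (1 - alpha) * z `^ alpha * x); last ring.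
  exact: cvgM.
Qed.

Lemma survival_partial_sum_cvg (u : nat -> R) (x : R) :
  u n @[n --> \oo] --> +oo -> 0 < x -> (forall k, 0 < u k) ->
  Q [set w | x `^ alpha^-1 * W 1 w = 1] = 0%E ->
  survival P (partial_sum xi (N (u k) x)) (u k) @[k --> \oo] -->
  survival Q (fun w => x `^ alpha^-1 * W 1 w) 1.
Proof.
move=> uoo x0 u0 Qx; pose Z w := x `^ alpha^-1 * W 1 w.
have mZ : measurable_fun setT Z by apply: measurable_funM => //; exact: measurable_funPT.
pose Y k w := partial_sum xi (N (u k) x) w / u k.
have mY k : measurable_fun setT (Y k) by exact: measurable_funM.
have Y0 k w : 0 <= Y k w by rewrite divr_ge0 ?(ltW (u0 k))// sumr_ge0.
have YE k : survival P (partial_sum xi (N (u k) x)) (u k) = survival P (Y k) 1.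
  congr (fine (P _)); apply/seteqP; split => w /=; rewrite /Y ltr_pdivlMr ?mul1r//.
under eq_cvg do rewrite YE.
apply/cvgrPdist_le => e e0.
have [| |dl dl0 H] := @laplace_survival_at _ _ _ _ _ P Q Y Z e mY Y0 mZ _ _ Qx e0.
- by move=> w; rewrite mulr_ge0 ?powR_ge0// (stable_ge0 W_stable).
- move=> z z0; rewrite (laplace_stable_scale a0 W_stable x0 z0) (laplace_stable W_stable (ltW x0) z0).
  exact: cvg_laplace_partial_sum.
near=> k; have [h1 h2] : survival P (Y k) (1 - dl) <= survival Q Z 1 + e /\
    survival Q Z 1 <= survival P (Y k) 1 + e by near: k.
have h3 : survival P (Y k) 1 <= survival P (Y k) (1 - dl).
  by apply: survival_ni => //; rewrite gerBl ltW.
by rewrite ler_distlC; apply/andP; split; [rewrite lerBlDr|exact: le_trans h1].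
Unshelve. all: by end_near. Qed.

Lemma lne_min_ge1_cvg_stable d2 (T2 : measurableType d2) (P' : probability T2 R)
    (hatS : nat -> {RV P' >-> R}) :
  independent P' [set n | (1 <= n)%N] hatS ->
  (forall n, (1 <= n)%N -> same_law P' P (hatS n) (partial_sum xi n)) ->
  let I := (\int[lebesgue_measure]_(x in `]0%R, +oo[)
        - lne (Q [set w | inverse_process W 1%R w <= x%:E]))%E in
  ((- lne (P' [set w | t%:E < min_ge1 hatS w]) *
        P [set w | (t < xi 0%N w)%R])%E @[t --> +oo] --> I) /\
  (I < +oo)%E.
Proof.
move=> indS lawS I.
pose f_ (t x : R) : \bar R := (- ln (survival P (partial_sum xi (N t x)) t))%:E.
pose f (x : R) : \bar R := (- lne (Q [set w | inverse_process W 1%R w <= x%:E]))%E.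
have F1 t : F t <= 1 by exact: survival_le1.
have pge n t : 1 - expR (- (n.+1%:R * F t)) <= survival P (partial_sum xi n.+1) t.
  exact: survival_partial_sum_ge.
have e0 n t : 0 < 1 - expR (- (n.+1%:R * F t)).
  by rewrite subr_gt0 expR_lt1 oppr_lt0 mulr_gt0// F0.
have p0 n t : 0 < survival P (partial_sum xi n.+1) t by exact: lt_le_trans (pge n t).
have p1 n t : survival P (partial_sum xi n.+1) t <= 1 by exact: survival_le1.
have pnd n m t : (n <= m)%N ->
    survival P (partial_sum xi n.+1) t <= survival P (partial_sum xi m.+1) t.
  move=> nm; rewrite -lee_fin !survivalE// le_measure ?inE//; try exact: measurable_gt.
  by move=> w /= /lt_le_trans; apply; exact: partial_sum_le.
have intf_ t : (- lne (P' [set w | t%:E < min_ge1 hatS w]) *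
    P [set w | (t < xi 0%N w)%R] = \int[lebesgue_measure]_(x in `]0%R, +oo[) f_ t x)%E.
  rewrite (lne_min_ge1_partial_sum t iX X0 indS lawS F0) -survivalE//.
  rewrite (@nneseries_step_integral _ (fun n => - ln (survival P (partial_sum xi n.+1) t)))//.
  - by move=> n; rewrite oppr_ge0 ln_le0.
  - by move=> n m nm; rewrite lerN2 ler_ln ?posrE// pnd.
have NF t x : 0 < x -> x <= (N t x)%:R * F t.
  move=> x0; have xF : 0 <= x / F t by rewrite divr_ge0// ltW// F0.
  by have /andP[_ /ltW] := truncn_itv xF; rewrite ler_pdivrMr ?F0.
have plow t x : 0 < x -> 1 - expR (- x) <= survival P (partial_sum xi (N t x)) t.
  move=> x0; apply: le_trans (pge _ _); rewrite lerD2l lerN2 ler_expR lerN2.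
  exact: NF.
pose h (v : R) : \bar R := (expR (- v) + v `^ (- 2^-1) * \1_(`]0, 1]%classic : set R) v)%:E.
(* The summand 2 serves x <= 1, where the power dominates; the other one serves x > 1, where the
   exponential does. *)
pose K : R := 2 + (1 - expR (- 1))^-1.
have ex1 : 0 < (1 - expR (- 1))^-1 :> R by rewrite invr_gt0 subr_gt0 expR_lt1 ltrN10.
have K0 : 0 < K by rewrite addr_gt0.
have mD : measurable (`]0, +oo[%classic : set R) by exact: measurable_itv.
have fh t x : `]0, +oo[%classic x -> (`|f_ t x| <= K%:E * h x)%E.
  move=> xD; have x0 : 0 < x by move: xD; rewrite /= in_itv/= andbT.
  rewrite gee0_abs; last by rewrite lee_fin oppr_ge0 ln_le0// p1.
  rewrite lee_fin.
  have ex : 0 < 1 - expR (- x) by rewrite subr_gt0 expR_lt1 oppr_lt0.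
  apply: (@le_trans _ _ (- ln (1 - expR (- x)))).
    by rewrite lerN2 ler_ln ?posrE ?p0// plow.
  have [xle1|xgt1] := leP x 1.
    apply: (le_trans (ln_one_sub_expRN_le x0)).
    rewrite indicE mem_set ?mulr1/= ?in_itv/= ?x0//.
    have := expR_gt0 (- x); have : 0 < x `^ (- 2^-1) by rewrite powR_gt0.
    move=> y0 z0; apply: ler_pM => //; first exact: ltW.
      by rewrite /K lerDl ltW.
    by rewrite lerDr ltW.
  rewrite indicE memNset/= ?in_itv/= ?x0 ?(leNgt x) ?xgt1// mulr0 addr0.
  apply: (le_trans (ln_one_sub_expRN_le_expR ltr01 (ltW xgt1))).
  by rewrite ler_pM2r ?expR_gt0// /K lerDr.
have ih : lebesgue_measure.-integrable (`]0, +oo[%classic : set R) h.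
  by apply: integrable_powRN_expRN; rewrite ?invr_gt0// invf_lt1// ltr1n.
have iKh : lebesgue_measure.-integrable (`]0, +oo[%classic : set R) (fun v => K%:E * h v)%E.
  exact: integrableZl.
have mf_ t : measurable_fun (`]0, +oo[%classic : set R) (f_ t).
  apply: measurable_funTS; apply/measurable_EFinP.
  apply: nonincreasing_measurable => // x y xy; rewrite lerN2 ler_ln ?posrE ?p0// pnd//.
  by apply: le_truncn; rewrite ler_pM2r ?invr_gt0 ?F0.
pose A x := [set w | (inverse_process W 1%R w <= x%:E)%E].
have mA x : 0 <= x -> measurable (A x) by move=> ?; exact: (measurable_inverse_process W_stable).
(* Clamped at 0, [H] is nondecreasing on the whole line, hence measurable, and [f] is a measurable
   function of it, with value +oo where [H] vanishes. *)
pose H (x : R) : R := fine (Q (A (Num.max x 0))).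
have mf : measurable_fun (`]0, +oo[%classic : set R) f.
  have mH : measurable_fun setT H.
    apply: nondecreasing_measurable => // x y xy.
    have m0 z : 0 <= Num.max z 0 :> R by rewrite le_max lexx orbT.
    rewrite fine_le ?fin_num_measure//; try by exact: mA.
    rewrite le_measure ?inE//; try by exact: mA.
    move=> w /= /le_trans; apply; rewrite lee_fin.
    by rewrite ge_max !le_max xy lexx orbT.
  apply: (eq_measurable_fun (fun x : R => if H x <= 0 then +oo%E else (- ln (H x))%:E)).
    move=> x; rewrite inE/= in_itv/= andbT => x0.
    rewrite /f -/(A x) -[Q (A x)]fineK ?fin_num_measure//; last by apply: mA; exact: ltW.
    by rewrite /H max_l ?(ltW x0)//=; case: ifP.
  apply: measurable_funTS; apply: measurable_fun_ifT => //.
    exact: measurable_fun_ler.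
  apply/measurable_EFinP; apply: measurableT_comp => //.
  exact: measurableT_comp.
have cvgf (u : nat -> R) : u n @[n --> \oo] --> +oo -> (forall k, 0 < u k) ->
    lebesgue_measure.-integrable (`]0, +oo[%classic : set R) f /\
    (\int[lebesgue_measure]_(x in `]0%R, +oo[) f_ (u k) x)%E @[k --> \oo] --> I.
  move=> uoo u0.
  have [] := dominated_convergence (mu := @lebesgue_measure R) (f_ := fun k => f_ (u k)) (f := f)
    (D := `]0, +oo[%classic) mD (fun k => mf_ (u k)) mf _ iKh _.
  - have [B [mB B0 BX]] := stable_null_ae W a0.
    exists B; split => // x nx; apply: BX => Qx; apply: nx => xD.
    have x0 : 0 < x by move: xD; rewrite /= in_itv/= andbT.
    have {}Qx := Qx x0.
    have cs := survival_partial_sum_cvg uoo x0 u0 Qx.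
    rewrite /f (inverse_process_survival a0 W_stable x0 Qx).
    set G := survival Q _ 1 in cs *.
    (* The bound 1 - e^(-x), uniform along the sequence, keeps the limit away from 0, where [ln]
       would not be continuous. *)
    have G0 : 0 < G.
      have ex : 0 < 1 - expR (- x) by rewrite subr_gt0 expR_lt1 oppr_lt0.
      apply: (lt_le_trans ex); apply: (cvgr_to_ge cs); apply: nearW => k.
      exact: plow.
    rewrite lne_EFin// -EFinN; apply: cvg_EFin; first exact: nearW.
    apply: cvgN; exact: (cvg_comp _ _ cs (continuous_ln G0)).
  - by apply: aeW => v n; exact: fh.
  - by move=> h1 _ h3.
(* Finiteness of I is a by-product of dominated convergence, so a single sequence, k + 1,
   suffices. *)
have [fint _] : lebesgue_measure.-integrable (`]0, +oo[%classic : set R) f /\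
    (\int[lebesgue_measure]_(x in `]0%R, +oo[) f_ (k.+1%:R) x)%E @[k --> \oo] --> I.
  apply: cvgf => //; have := @cvgr_idn R.
  by rewrite -(cvg_shiftn 1) /= => hh; under eq_cvg do rewrite -addn1.
split; last exact: integrable_lty.
under eq_cvg do rewrite intf_.
apply/cvge_pinftyP => u uoo.
have [M _ HM] : \forall n \near \oo, 0 < u n by move/cvgryPgt : uoo; exact.
rewrite -(cvg_shiftn M) /=.
have [] // := cvgf (fun n => u (n + M)%N).
  by rewrite (cvg_shiftn M u).
by move=> k; apply: HM => /=; rewrite leq_addl.
Qed.

End part_a.

(** * The case alpha > 1: power bounds and moments *)

(** For u > 1 the last term alone suffices, as u^p >= 1. For u <= 1, (1 - u) e^u <= 1 times 1 + u
    gives e^u <= 1 + u + u^2 e^u, and u^2 <= u^p. A power p < 2 is allowed because xi may lack a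
    second moment. *)
Lemma expR_le_quadratic (R : realType) (u p : R) : 0 <= u -> 1 < p -> p <= 2 ->
  expR u <= 1 + u + u `^ p * expR u.
Proof.
move=> u0 p1 p2; have e0 := expR_gt0 u.
have [u1|u1] := leP u 1; last first.
  have : 1 <= u `^ p by rewrite -[leLHS](powRr0 u); apply: ler_powR; [exact: ltW|lra].
  by move=> h; nra.
have up : u ^+ 2 <= u `^ p.
  move: u0; rewrite le_eqVlt => /predU1P[<-|u0]; first by rewrite expr0n powR_ge0.
  rewrite -powR_mulrn ?(ltW u0)//; apply: ger_powR => //.
  by rewrite u0.
have h : (1 - u) * expR u <= 1.
  rewrite -ler_pdivlMr// mul1r -expRN; exact: expR_ge1Dx.
have h2 : (1 + u) * ((1 - u) * expR u) <= 1 + u by rewrite ler_piMr// addr_ge0.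
have h3 : u ^+ 2 * expR u <= u `^ p * expR u by rewrite ler_pM2r.
nra.
Qed.

Lemma ln_powR_bound (R : realType) (t p q : R) : 1 <= t -> 0 < p -> 0 < q ->
  (ln t) `^ p * t `^ (- q) <= (p / q) `^ p.
Proof.
move=> t1 p0 q0; have t0 : 0 < t by exact: lt_le_trans t1.
have l0 : 0 <= ln t by rewrite ln_ge0.
have h : ln t <= p / q * t `^ (q / p).
  have h1 : ln (t `^ (q / p)) <= t `^ (q / p) by rewrite ltW// ln_sublinear// powR_gt0.
  rewrite ln_powR in h1.
  rewrite -[p / q]invf_div mulrC ler_pdivlMr ?divr_gt0// mulrC.
  exact: h1.
rewrite powRN ler_pdivrMr ?powR_gt0//.
have -> : (p / q) `^ p * t `^ q = (p / q * t `^ (q / p)) `^ p.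
  rewrite [RHS]powRM ?powR_ge0 ?divr_ge0 ?ltW// -[in RHS]powRrM; congr (_ * _ `^ _).
  by field; rewrite gt_eqF.
apply: ge0_ler_powR; rewrite ?nnegrE ?(ltW p0)//.
by rewrite mulr_ge0 ?powR_ge0// divr_ge0// ltW.
Qed.

(** Potter from the fixed point t0; below t0, F <= 1 and the constant (2 t0)^beta absorbs the
    power. *)
Lemma survival_powR_le (R : realType) (F : R -> R) (alpha beta : R) :
  {homo F : s t / s <= t >-> t <= s} -> (forall t, 0 < F t) -> (forall t, F t <= 1) ->
  F (2 * t) / F t @[t --> +oo] --> 2 `^ (- alpha) -> 0 < beta -> beta < alpha ->
  exists2 C, 0 < C & forall t, 0 < t -> F t <= C * t `^ (- beta).
Proof.
move=> Fni F0 F1 F2 b0 ba.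
have [t0 t00 H] := potter_upper Fni F0 F2 b0 ba.
pose C := (2 * t0) `^ beta.
exists C => [|t t_gt0]; first by rewrite powR_gt0// mulr_gt0.
have [tt0|tt0] := leP t0 t.
  apply: (le_trans (H _ _ (lexx t0) tt0)).
  have -> : C * t `^ (- beta) = 2 `^ beta * (t / t0) `^ (- beta).
    rewrite /C powRM ?(ltW t00)// -mulrA; congr (_ * _).
    rewrite powRM ?invr_ge0 ?(ltW t00) ?(ltW t_gt0)// mulrC; congr (_ * _).
    by rewrite -powR_inv1 ?(ltW t00)// -powRrM mulrNN mul1r.
  by rewrite ler_piMr// mulr_ge0// powR_ge0.
apply: (le_trans (F1 _)); rewrite powRN ler_pdivlMr ?powR_gt0// mul1r.
apply: ge0_ler_powR; rewrite ?nnegrE ?ltW//; first by rewrite mulr_gt0.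
by rewrite (lt_trans tt0)// ltr_pMl// ltr1n.
Qed.

Lemma survival_lower_le (R : realType) (F : R -> R) (alpha beta : R) :
  {homo F : s t / s <= t >-> t <= s} -> (forall t, 0 < F t) ->
  F (2 * t) / F t @[t --> +oo] --> 2 `^ (- alpha) -> 0 < alpha -> alpha < beta ->
  exists C t0, forall t, t0 <= t -> - ln (F t) <= beta * ln t + C.
Proof.
move=> Fni F0 F2 a0 ab.
have [t0 t00 H] := potter_lower Fni F0 F2 a0 ab.
exists (- ln (F t0) - beta * ln t0 + beta * ln 2), t0 => t tt0.
have t_gt0 : 0 < t by exact: lt_le_trans tt0.
have := H _ _ (lexx t0) tt0.
have r0 : 0 < t / t0 by rewrite divr_gt0.
rewrite -ler_ln ?posrE ?mulr_gt0 ?powR_gt0//.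
rewrite !lnM ?posrE ?mulr_gt0 ?powR_gt0// !ln_powR ln_div ?posrE// => h.
clear - h; lra.
Qed.

(** X^p <= 1 + sum_k 2^((k+1) p) 1_(X > 2^k / 2), whose expectation is a geometric series of ratio
    2^(-(beta - p)). The halved threshold turns 2^k <= X into a strict inequality. *)
Lemma moment_lty d (T : measurableType d) (R : realType) (P : probability T R)
    (X : T -> R) (beta p C : R) :
  measurable_fun setT X -> (forall w, 0 <= X w) -> 0 < p -> p < beta -> 0 < C ->
  (forall t, 0 < t -> survival P X t <= C * t `^ (- beta)) ->
  (\int[P]_w ((X w) `^ p)%:E < +oo)%E.
Proof.
move=> mX X0 p0 pb C0 HC.
pose g k (w : T) : \bar R :=
  ((2 ^+ k.+1) `^ p * \1_[set w | 2 ^+ k / 2 < X w] w)%:E.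
have g0 k w : (0 <= g k w)%E by rewrite lee_fin mulr_ge0 ?powR_ge0// indicE.
have mg k : measurable_fun setT (g k).
  apply/measurable_EFinP; apply: measurable_funM => //.
  by apply: measurable_indic; exact: measurable_gt.
have mp : measurable_fun setT (fun w => ((X w) `^ p)%:E).
  by apply/measurable_EFinP; apply: (measurableT_comp (measurable_powR _)).
apply: (@le_lt_trans _ _ (\int[P]_w (1 + \sum_(0 <= k <oo) g k w))%E).
  apply: ge0_le_integral => //.
  - by move=> w _; rewrite lee_fin powR_ge0.
  - apply: emeasurable_funD => //; apply: ge0_emeasurable_sum => //.
  - move=> w _; have s0 : (0 <= \sum_(0 <= k <oo) g k w)%E by apply: nneseries_ge0.
    have [x1|x1] := leP 1 (X w); last first.
      apply: (@le_trans _ _ 1%E); last by rewrite leeDl.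
      rewrite lee_fin; apply: (@le_trans _ _ (1 `^ p)); last by rewrite powR1.
      by apply: ge0_ler_powR; rewrite ?nnegrE ?(ltW p0) ?(ltW x1).
    have [n [nl nr]] := dyadic_bracket x1.
    apply: (@le_trans _ _ (g n w)).
      rewrite lee_fin indicE mem_set ?mulr1/=.
        by apply: ge0_ler_powR; rewrite ?nnegrE ?exprn_ge0// ltW.
      by rewrite (lt_le_trans _ nl)// ltr_pdivrMr// ltr_pMr ?exprn_gt0// ltr1n.
    apply: (@le_trans _ _ (\sum_(0 <= k <oo) g k w)%E); last by rewrite leeDr.
    apply: (@le_trans _ _ (\sum_(0 <= k < n.+1) g k w)%E).
      by rewrite big_nat_recr//= leeDr// sume_ge0.
    by apply: nneseries_lim_ge.
rewrite ge0_integralD//; last first.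
- by apply: ge0_emeasurable_sum.
- by move=> w _; apply: nneseries_ge0.
rewrite integral_cst//= probability_setT mul1e integral_nneseries//.
rewrite lte_add_pinfty ?ltry//.
pose c := (beta - p) * ln 2.
have c0 : 0 < c by rewrite mulr_gt0 ?subr_gt0// ln_gt0// ltr1n.
pose K := C * 4 `^ beta.
have K0 : 0 <= K by rewrite mulr_ge0 ?powR_ge0// ltW.
apply: le_lt_trans (nneseries_expR_lty c0 K0).
apply: lee_nneseries => k _; first by move=> _; apply: integral_ge0.
rewrite /g; under eq_integral do rewrite EFinM.
rewrite ge0_integralZl_EFin ?powR_ge0//; last first.
  by apply/measurable_EFinP; apply: measurable_indic; exact: measurable_gt.
rewrite integral_indic ?setIT//; last exact: measurable_gt.
rewrite [X in (_ * X)%E](_ : _ = (survival P X (2 ^+ k / 2))%:E); last by rewrite survivalE.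
have E (m : nat) : (2 : R) ^+ m = expR (m%:R * ln 2) by rewrite expRM_natl lnK// posrE.
rewrite -EFinM lee_fin.
have k20 : 0 < (2 : R) ^+ k / 2 by rewrite divr_gt0// exprn_gt0.
apply: (@le_trans _ _ ((2 ^+ k.+1) `^ p * (C * (2 ^+ k / 2) `^ (- beta)))).
  by rewrite ler_wpM2l ?powR_ge0// HC.
have -> : (2 : R) ^+ k / 2 = 2 ^+ k.+1 / 4 by rewrite exprS; field.
rewrite powRM ?exprn_ge0 ?invr_ge0//.
have -> : (4^-1 : R) `^ (- beta) = 4 `^ beta.
  by rewrite -powR_inv1// -powRrM mulrNN mul1r.
rewrite /K [leLHS](_ : _ = C * 4 `^ beta * ((2 ^+ k.+1) `^ p * (2 ^+ k.+1) `^ (- beta))); last by ring.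
rewrite ler_wpM2l// E /powR gt_eqF ?expR_gt0// expRK -expRD ler_expR /c le_eqVlt.
by apply/orP; left; apply/eqP; ring.
Qed.

(** * Upper bound on P(S_n > t) for n below t / mu *)

Section part_b.
Context d (T : measurableType d) (R : realType) (P : probability T R).
Variables (xi : nat -> {RV P >-> R}).
Hypotheses (iX : iid P xi) (X0 : forall n w, 0 <= xi n w).
Let F := survival P (xi 0%N).
Hypothesis F0 : forall t, 0 < F t.
Let mxi n : measurable_fun setT (xi n). Proof. exact: measurable_funPT. Qed.
Let mS n : measurable_fun setT (partial_sum xi n).
Proof. exact: partial_sum_measurable. Qed.
Let mu : R := \int[P]_w xi 0%N w.
Hypothesis imu : P.-integrable setT (EFin \o xi 0%N).

Lemma mean_gt0 : 0 < mu.
Proof.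
have [ii Ei] := Rintegral_gt P 1 (mxi 0%N).
apply: (@lt_le_trans _ _ (survival P (xi 0%N) 1)); first exact: F0.
rewrite -Ei; apply: le_Rintegral => // w _.
rewrite /= indicE; case: (boolP (w \in _)) => h; last exact: X0.
by move: h; rewrite inE/= => /ltW.
Qed.

(* Either some summand exceeds y, or the sum of the truncated summands exceeds t;
   the second event is handled by Chernoff's bound. *)
Lemma survival_partial_sum_trunc (n : nat) (t h y : R) : 0 <= h -> 0 <= y ->
  survival P (partial_sum xi n) t <=
  n%:R * F y + expR (- (h * t)) *
    (\int[P]_w (expR (h * xi 0%N w) * \1_[set x | x <= y] (xi 0%N w)))%R ^+ n.
Proof.
move=> h0 y0; pose f (x : R) := expR (h * x) * \1_[set x | x <= y] x.
have my : measurable [set x : R | x <= y] by rewrite -set_itvNyc; exact: measurable_itv.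
have mf : measurable_fun setT f.
  apply: measurable_funM; last exact: measurable_indic.
  by apply: measurableT_comp => //; exact: measurable_funM.
have f0 x : 0 <= f x by rewrite mulr_ge0 ?expR_ge0// indicE.
have mfx k : measurable_fun setT (fun w => f (xi k w)) by exact: measurableT_comp.
have fbound x : 0 <= x -> f x <= expR (h * y).
  move=> x0; rewrite /f indicE; case: (boolP (x \in _)) => hx.
    by rewrite mulr1 ler_expR ler_wpM2l//; move: hx; rewrite inE.
  by rewrite mulr0 expR_ge0.
have fif : (\int[P]_w (f (xi 0%N w))%:E < +oo)%E.
  apply: (@le_lt_trans _ _ (\int[P]_w (expR (h * y))%:E)%E).
    apply: ge0_le_integral => //.
    - by move=> w _; rewrite lee_fin.
    - exact/measurable_EFinP.
    - by move=> w _; rewrite lee_fin fbound.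
  by rewrite integral_cst//= probability_setT mule1 ltry.
have ffin : (\int[P]_w (f (xi 0%N w))%:E)%E \is a fin_num.
  by rewrite ge0_fin_numE//; apply: integral_ge0 => w _; rewrite lee_fin.
have Eprod := integral_prod_iid n iX mf f0 fif.
rewrite -lee_fin survivalE//.
pose g (w : T) : \bar R := (\sum_(1 <= k < n.+1) (\1_[set w | y < xi k w] w : R) +
   expR (- (h * t)) * \prod_(1 <= k < n.+1) f (xi k w))%:E.
have mi k : measurable_fun setT (\1_[set w | y < xi k w] : T -> R).
  by apply: measurable_indic; exact: measurable_gt.
have mprod : measurable_fun setT (fun w => \prod_(1 <= k < n.+1) f (xi k w)).
  by apply: measurable_prod.
have msum : measurable_fun setT
    (fun w => \sum_(1 <= k < n.+1) (\1_[set w | y < xi k w] w : R)).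
  by apply: measurable_sum.
apply: (@le_trans _ _ (\int[P]_w g w)%E).
  rewrite -[X in P X]setIT -integral_indic//; last exact: measurable_gt.
  apply: ge0_le_integral => //.
  - by apply/measurable_EFinP; apply: measurable_indic; exact: measurable_gt.
  - by apply/measurable_EFinP; apply: measurable_funD => //; exact: measurable_funM.
  move=> w _; rewrite lee_fin.
  have s0 : 0 <= \sum_(1 <= k < n.+1) (\1_[set w | y < xi k w] w : R).
    by apply: sumr_ge0 => k _; rewrite indicE.
  have q0 : 0 <= expR (- (h * t)) * \prod_(1 <= k < n.+1) f (xi k w).
    by rewrite mulr_ge0 ?expR_ge0// prodr_ge0.
  rewrite indicE; case: (boolP (w \in _)) => St; last by rewrite addr_ge0.
  move: St; rewrite inE/= => St.
  case: (pselect (exists2 k, k \in index_iota 1 n.+1 & y < xi k w)) => [[k kn yk]|nk].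
    apply: (@le_trans _ _ (\sum_(1 <= k < n.+1) (\1_[set w | y < xi k w] w : R))).
      rewrite (bigD1_seq k) ?iota_uniq//= indicE mem_set//= lerDl.
      by apply: sumr_ge0 => j _; rewrite indicE.
    by rewrite lerDl.
  rewrite -[leLHS]add0r lerD//.
  rewrite (_ : \prod_(1 <= k < n.+1) f (xi k w) = expR (h * partial_sum xi n w)).
    rewrite -expRD -[leLHS]expR0 ler_expR addrC -mulrBr mulr_ge0// subr_ge0 ltW//.
  rewrite /partial_sum mulr_sumr expR_sum big_seq [RHS]big_seq; apply: eq_bigr => k kn.
  rewrite /f indicE mem_set ?mulr1//= leNgt; apply/negP => yk.
  by apply: nk; exists k.
rewrite /g; under eq_integral do rewrite EFinD.
rewrite ge0_integralD//; last 4 first.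
- by move=> w _; rewrite lee_fin; apply: sumr_ge0 => k _; rewrite indicE.
- exact/measurable_EFinP.
- by move=> w _; rewrite lee_fin mulr_ge0 ?expR_ge0// prodr_ge0.
- by apply/measurable_EFinP; exact: measurable_funM.
rewrite EFinD leeD//.
  under eq_integral do rewrite -sumEFin.
  rewrite ge0_integral_sum//; last by move=> k; apply/measurable_EFinP.
  rewrite (eq_bigr (fun=> (F y)%:E)); last first.
    move=> k _; rewrite integral_indic ?setIT//; last exact: measurable_gt.
    rewrite survivalE// !preimage_gt; have [_ sl] := iX; apply: (sl k).
    exact: measurable_itv.
  by rewrite sumEFin sumr_const_nat subn1/= mulr_natl.
under eq_integral do rewrite EFinM.
rewrite ge0_integralZl_EFin ?expR_ge0//; last 2 first.
- by move=> w _; rewrite lee_fin prodr_ge0.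
- exact/measurable_EFinP.
by rewrite Eprod EFinM EFin_expe /Rintegral fineK.
Qed.

(** [expR_le_quadratic] at u = h xi; only in the remainder is e^(h xi) replaced by e^(h y), so the
    first-order term keeps the exact mean. *)
Lemma truncated_exp_moment (h y p : R) : 0 <= h -> 0 <= y -> 1 < p -> p <= 2 ->
  P.-integrable setT (EFin \o (fun w => xi 0%N w `^ p)) ->
  (\int[P]_w (expR (h * xi 0%N w) * \1_[set x | x <= y] (xi 0%N w)))%R <=
  1 + h * mu + h `^ p * expR (h * y) * (\int[P]_w (xi 0%N w `^ p))%R.
Proof.
move=> h0 y0 p1 p2 ip.
have ic : P.-integrable setT (EFin \o (fun=> 1 : R)) by exact: finite_measure_integrable_cst.
have iZ (c : R) (f : T -> R) : P.-integrable setT (EFin \o f) ->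
    P.-integrable setT (EFin \o (fun w => c * f w)).
  move=> fi; rewrite (_ : _ \o _ = (fun w => c%:E * (EFin \o f) w)%E)//.
  exact: integrableZl.
have iD (f g : T -> R) : P.-integrable setT (EFin \o f) ->
    P.-integrable setT (EFin \o g) -> P.-integrable setT (EFin \o (fun w => f w + g w)).
  move=> fi gi; rewrite (_ : _ \o _ = ((EFin \o f) \+ (EFin \o g))%E)//.
  exact: integrableD.
have E1 : (\int[P]_w (1 : R))%R = 1 by rewrite Rintegral_cst//= probability_setT mulr1.
have i1 := iZ h _ imu; have i2 := iZ (h `^ p * expR (h * y)) _ ip.
rewrite -[in X in _ <= X + _ + _]E1 /mu -!RintegralZl//.
rewrite -!RintegralD//; last exact: iD.
have my : measurable [set x : R | x <= y] by rewrite -set_itvNyc; exact: measurable_itv.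
apply: le_Rintegral => //.
- apply: measurable_bounded_integrable => //.
  + by rewrite (le_lt_trans (probability_le1 _ _))// ltry.
  + apply: measurable_funM; last by apply: measurableT_comp => //; exact: measurable_indic.
    by apply: measurableT_comp => //; exact: measurable_funM.
  + exists (expR (h * y)); split => // M M1 w _ /=; apply: le_trans (ltW M1).
    rewrite ger0_norm ?mulr_ge0 ?expR_ge0// indicE; case: (boolP (_ \in _)) => hx.
      by rewrite mulr1 ler_expR ler_wpM2l//; move: hx; rewrite inE.
    by rewrite mulr0 expR_ge0.
- by apply: (iD) => //; apply: (iD).
move=> w _; set x := xi 0%N w; have x0 : 0 <= x by exact: X0.
have hx0 : 0 <= h * x by rewrite mulr_ge0.
have xp : 0 <= x `^ p by exact: powR_ge0.
have hp : 0 <= h `^ p by exact: powR_ge0.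
rewrite indicE; case: (boolP (_ \in _)) => hx; last first.
  by rewrite mulr0 !addr_ge0// !mulr_ge0 ?expR_ge0.
rewrite mulr1 (le_trans (expR_le_quadratic hx0 p1 p2))// lerD2l powRM// -!mulrA.
rewrite ler_wpM2l// mulrC ler_wpM2r// ler_expR ler_wpM2l//.
by move: hx; rewrite inE.
Qed.

(** Truncation at y t and tilt h = lam ln t / t. A summand above y t costs n F(y t), of order t^(1 -
    beta). Otherwise the exponent is at most -h (t - n mu) <= -dl h t = -beta ln t, up to a bounded
    remainder. *)
Lemma survival_partial_sum_le (beta dl C : R) :
  1 < beta -> 0 < dl -> dl < 1 -> 0 < C ->
  (forall t, 0 < t -> F t <= C * t `^ (- beta)) ->
  exists2 K, 0 < K & forall t n, 1 <= t -> n%:R <= (1 - dl) * t / mu ->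
    survival P (partial_sum xi n) t <= K * t `^ (1 - beta).
Proof.
move=> b1 dl0 dl1 C0 HC; have mu0 := mean_gt0.
(* Above 1 to make the remainder small, below beta for a finite moment, at most 2 for the quadratic
   bound. *)
pose p := Num.min 2 ((1 + beta) / 2).
have p1 : 1 < p by rewrite lt_min; apply/andP; split; lra.
have p2 : p <= 2 by rewrite ge_min lexx.
have pb : p < beta by rewrite gt_min; apply/orP; right; lra.
have p0 : 0 < p by exact: lt_trans p1.
have mxp : measurable_fun setT (fun w => xi 0%N w `^ p).
  by apply: (measurableT_comp (measurable_powR _)).
have ip : P.-integrable setT (EFin \o (fun w => xi 0%N w `^ p)).
  apply/integrableP; split; first exact/measurable_EFinP.
  under eq_integral do rewrite /= ger0_norm ?powR_ge0//.
  exact: (moment_lty (mxi 0%N) (X0 0%N) p0 pb C0 HC).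
pose m := (\int[P]_w (xi 0%N w `^ p))%R.
have m0 : 0 <= m by apply: Rintegral_ge0 => w _; exact: powR_ge0.
pose lam := beta / dl; have lam0 : 0 < lam by rewrite divr_gt0//; lra.
pose q := (p - 1) / 2; have q0 : 0 < q by rewrite divr_gt0//; lra.
pose y := q / lam; have y0 : 0 < y by rewrite divr_gt0.
(* As e^(h y t) = t^q and 1 - p + q = -q, the remainder n h^p t^q m is at most (m / mu) lam^p (ln
   t)^p t^(-q), which [ln_powR_bound] bounds by [B]. *)
pose B := m / mu * lam `^ p * (p / q) `^ p.
have B0 : 0 <= B by rewrite !mulr_ge0 ?powR_ge0 ?invr_ge0// ltW.
exists (C * y `^ (- beta) / mu + expR B).
  by rewrite addr_gt0 ?expR_gt0// !mulr_gt0 ?powR_gt0 ?invr_gt0.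
move=> t n t1 nt; have t0 : 0 < t by exact: lt_le_trans t1.
have l0 : 0 <= ln t by rewrite ln_ge0.
pose h := lam * ln t / t.
have h0 : 0 <= h by rewrite divr_ge0 ?(ltW t0)// mulr_ge0 ?(ltW lam0).
have yt0 : 0 < y * t by rewrite mulr_gt0.
have n0 : 0 <= n%:R :> R by [].
have nmu : n%:R * mu <= (1 - dl) * t by rewrite -ler_pdivlMr.
have dt : (1 - dl) * t <= t by rewrite ler_piMl ?(ltW t0)//; lra.
have ntmu : n%:R <= t / mu by rewrite ler_pdivlMr//; exact: le_trans dt.
apply: (le_trans (survival_partial_sum_trunc n t h0 (ltW yt0))).
rewrite mulrDl lerD//.
  apply: (@le_trans _ _ (t / mu * (C * (y * t) `^ (- beta)))).
    by apply: ler_pM => //; [exact/ltW/F0|exact: HC].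
  rewrite powRM ?(ltW y0) ?(ltW t0)// le_eqVlt; apply/orP; left; apply/eqP.
  have -> : t `^ (1 - beta) = t * t `^ (- beta).
    by rewrite powRD ?(gt_eqF t0) ?implybT// powRr1 ?ltW.
  by ring.
have ht : h * t = lam * ln t by rewrite /h mulfVK// gt_eqF.
set M := (\int[P]_w _)%R.
have M0 : 0 <= M by apply: Rintegral_ge0 => w _; rewrite mulr_ge0 ?expR_ge0// indicE.
have Mle : M <= expR (h * mu + h `^ p * expR (h * (y * t)) * m).
  apply: (le_trans (truncated_exp_moment h0 (ltW yt0) p1 p2 ip)).
  by rewrite -addrA; exact: expR_ge1Dx.
apply: (@le_trans _ _ (expR (- (h * t)) *
    expR (n%:R * (h * mu + h `^ p * expR (h * (y * t)) * m)))).
  rewrite ler_pM2l ?expR_gt0// expRM_natl.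
  by apply: lerXn2r; rewrite ?nnegrE ?expR_ge0.
have E1 : expR (h * (y * t)) = t `^ q.
  rewrite mulrCA ht /powR gt_eqF//; congr expR; rewrite /y.
  by field; rewrite gt_eqF.
have step : n%:R * (h `^ p * expR (h * (y * t)) * m) <= B.
  rewrite E1.
  have hpE : h `^ p = lam `^ p * (ln t) `^ p * t `^ (- p).
    have lln : 0 <= lam * ln t by rewrite mulr_ge0 ?(ltW lam0).
    rewrite /h powRM ?invr_ge0 ?(ltW t0)//.
    rewrite powRM ?(ltW lam0)//; congr (_ * _).
    by rewrite -powR_inv1 ?(ltW t0)// -powRrM mulN1r.
  have c0 : 0 <= h `^ p * t `^ q * m by rewrite !mulr_ge0 ?powR_ge0.
  apply: (@le_trans _ _ (t / mu * (h `^ p * t `^ q * m))); first by rewrite ler_wpM2r.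
  have tE : t * t `^ (- p) * t `^ q = t `^ (- q).
    rewrite -[X in X * _ * _](powRr1 (ltW t0)) -!powRD ?(gt_eqF t0) ?implybT//.
    by congr (_ `^ _); rewrite /q; field.
  rewrite hpE [leLHS](_ : _ = m / mu * lam `^ p * (ln t `^ p * (t * t `^ (- p) * t `^ q))); last by ring.
  rewrite tE /B ler_wpM2l ?mulr_ge0 ?powR_ge0 ?invr_ge0 ?(ltW mu0)//.
  exact: ln_powR_bound.
rewrite -expRD mulrDr.
apply: (@le_trans _ _ (expR (B - beta * ln t))).
  rewrite ler_expR.
  have h1 : n%:R * (h * mu) <= (1 - dl) * (lam * ln t).
    rewrite -ht mulrCA [leRHS]mulrCA ler_wpM2l//.
  have h2 : dl * (lam * ln t) = beta * ln t by rewrite /lam; field; rewrite gt_eqF.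
  rewrite ht; clear - h1 h2 step; lra.
rewrite expRD ler_pM2l ?expR_gt0// /powR gt_eqF// ler_expR mulrBl mul1r.
by rewrite lerDr.
Qed.

End part_b.

(** * The sum of -ln P(S_n > t) from above and below *)

(** The weak Stirling bound for ln n!; the induction step is m ln(1 + 1/m) <= 1. *)
Lemma sum_ln_ge (R : realType) (n : nat) :
  n%:R * ln (n%:R : R) - n%:R <= \sum_(1 <= k < n.+1) ln (k%:R : R).
Proof.
elim: n => [|n IH]; first by rewrite mul0r subr0 big_geq.
rewrite big_nat_recr//=.
case: n IH => [|n] IH; first by rewrite big_geq// mulr1n ln1 mulr0 add0r; lra.
set m := n.+1 in IH *.
have m0 : 0 < m%:R :> R by rewrite ltr0n.
have m10 : 0 < m.+1%:R :> R by rewrite ltr0n.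
have h : m%:R * (ln m.+1%:R - ln m%:R) <= 1 :> R.
  rewrite -ln_div ?posrE//.
  have -> : (m.+1%:R / m%:R : R) = 1 + m%:R^-1 by rewrite -natr1; field; rewrite gt_eqF.
  rewrite mulrC -ler_pdivlMr// mul1r; apply: le_ln1Dx.
  by rewrite (@lt_trans _ _ 0)// ?ltrN10// invr_gt0.
have e1 : m.+1%:R = m%:R + 1 :> R by rewrite natr1.
move: h IH; rewrite e1; set x := m%:R; set a := ln (x + 1); set b := ln x.
set S := \sum_(1 <= k < m.+1) _; clearbody a b S x; clear; nra.
Qed.

Section part_b_upper.
Context d (T : measurableType d) (R : realType) (P : probability T R).
Variables (xi : nat -> {RV P >-> R}).
Hypotheses (iX : iid P xi) (X0 : forall n w, 0 <= xi n w).
Let F := survival P (xi 0%N).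
Hypothesis F0 : forall t, 0 < F t.
Let mxi n : measurable_fun setT (xi n). Proof. exact: measurable_funPT. Qed.
Let mS n : measurable_fun setT (partial_sum xi n).
Proof. exact: partial_sum_measurable. Qed.
Let mu : R := \int[P]_w xi 0%N w.
Hypothesis imu : P.-integrable setT (EFin \o xi 0%N).

(** (1 - E e^(-z xi)) / z tends to mu as z decreases to 0 along 1/(k+1), by domination with xi. For
    some z it exceeds kappa, and 1 - z kappa <= e^(-z kappa). *)
Lemma laplace_le_expR (kappa : R) : kappa < mu ->
  exists2 z, 0 < z & laplace P (xi 0%N) z <= expR (- (z * kappa)).
Proof.
move=> km.
pose f_ k w : \bar R := (k.+1%:R * (1 - expR (- (k.+1%:R^-1) * xi 0%N w)))%:E.
have f0 k w : 0 <= k.+1%:R * (1 - expR (- (k.+1%:R^-1) * xi 0%N w)) :> R.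
  by rewrite mulr_ge0// subr_ge0 expR_le1 mulNr oppr_le0 mulr_ge0// invr_ge0.
have fle k w : k.+1%:R * (1 - expR (- (k.+1%:R^-1) * xi 0%N w)) <= xi 0%N w :> R.
  have h := expR_ge1Dx (- (k.+1%:R^-1) * xi 0%N w).
  have a0 : 0 < k.+1%:R^-1 :> R by rewrite invr_gt0.
  have -> : k.+1%:R = (k.+1%:R^-1)^-1 :> R by rewrite invrK.
  move: h a0; rewrite invrK; set a : R := k.+1%:R^-1; rewrite mulNr => h a0.
  rewrite -[k.+1%:R]invrK -/a mulrC ler_pdivrMr// [_ * a]mulrC.
  by rewrite lerBlDl -lerBlDr.
have mf_ k : measurable_fun setT (f_ k).
  apply/measurable_EFinP; apply: measurable_funM => //.
  apply: measurable_funB => //; apply: measurableT_comp => //; exact: measurable_funM.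
have cf w : f_ k w @[k --> \oo] --> (xi 0%N w)%:E.
  apply: cvg_EFin; first exact: nearW.
  (* The lower bound is e^(-u) <= 1 / (1 + u) <= 1 - u + u^2 at u = x / (k+1). *)
  apply: (@squeeze_cvgr _ _ _ _ (fun k => xi 0%N w - xi 0%N w ^+ 2 * k.+1%:R^-1) (fun=> xi 0%N w)).
  - apply: nearW => k; rewrite fle andbT /f_ /=.
    set x := xi 0%N w; have x0 : 0 <= x by exact: X0.
    set a : R := k.+1%:R^-1; have a0 : 0 < a by rewrite invr_gt0.
    have -> : k.+1%:R = a^-1 :> R by rewrite invrK.
    rewrite [leRHS]mulrC ler_pdivlMr// mulNr.
    have u0 : 0 <= a * x by rewrite mulr_ge0// ltW.
    have e1 := expR_ge1Dx (a * x).
    have ed : 0 < 1 + a * x by lra.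
    have h1 : expR (- (a * x)) <= (1 + a * x)^-1.
      by rewrite expRN lef_pV2 ?posrE ?expR_gt0.
    have h2 : (1 + a * x)^-1 <= 1 - a * x + (a * x) ^+ 2.
      have u3 := exprn_ge0 3 u0.
      rewrite -div1r ler_pdivrMr// [leRHS](_ : _ = 1 + (a * x) ^+ 3) ?lerDl//.
      by move: (a * x) => u; ring.
    rewrite mulrBl [x * a]mulrC (_ : x ^+ 2 * a * a = (a * x) ^+ 2); last ring.
    lra.
  - rewrite -[X in _ --> X]subr0; apply: cvgB; first exact: cvg_cst.
    rewrite -(mulr0 (xi 0%N w ^+ 2)); apply: cvgM; first exact: cvg_cst.
    exact: cvg_harmonic.
  - exact: cvg_cst.
have Ef k : (\int[P]_w f_ k w)%E = (k.+1%:R * (1 - laplace P (xi 0%N) k.+1%:R^-1))%:E.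
  have z0 : 0 <= k.+1%:R^-1 :> R by rewrite invr_ge0.
  have il := integrable_expRN P (mxi 0%N) (X0 0%N) z0.
  have ic : P.-integrable setT (EFin \o (fun=> 1 : R)).
    exact: finite_measure_integrable_cst.
  rewrite /f_; under eq_integral do rewrite EFinM.
  rewrite integralZl//; last first.
    exact: (integrableB measurableT ic il).
  rewrite EFinM; congr (_ * _)%E; under eq_integral do rewrite EFinB.
  rewrite (integralB_EFin measurableT ic il).
  rewrite integral_cst//= probability_setT mul1e EFinB /laplace /Rintegral fineK//.
  exact: integrable_fin_num.
have cI : (\int[P]_w f_ k w)%E @[k --> \oo] --> (\int[P]_w (xi 0%N w)%:E)%E.
  have [] := dominated_convergence (mu := P) (f_ := f_) (f := EFin \o xi 0%N)
    (D := setT) measurableT mf_ _ _ imu _.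
  - exact/measurable_EFinP.
  - by apply: aeW => w _; exact: cf.
  - by apply: aeW => w k _; rewrite /f_ gee0_abs ?lee_fin.
  - by move=> _ _.
have cl : k.+1%:R * (1 - laplace P (xi 0%N) k.+1%:R^-1) @[k --> \oo] --> mu.
  have EI : (\int[P]_w (xi 0%N w)%:E)%E = mu%:E.
    by rewrite /mu /Rintegral fineK//; exact: integrable_fin_num.
  move: cI; rewrite EI => /fine_cvg; apply: cvg_trans; apply: near_eq_cvg.
  by apply: nearW => k /=; rewrite Ef.
have [k _ /(_ k (leqnn k))/= hk] := cvgr_gt _ cl _ km.
exists k.+1%:R^-1; first by rewrite invr_gt0.
apply: le_trans (expR_ge1Dx _).
have k0 : 0 < k.+1%:R :> R by [].
move: hk; rewrite mulrC -ltr_pdivrMr// [kappa / _]mulrC => hk.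
by rewrite lerBrDr -lerBrDl ltW.
Qed.

(** Chernoff for the lower tail: t <= n mu r with r = 1 / (1 + dl), and kappa = mu (1 + r) / 2 is
    the midpoint of mu r and mu, so P(S_n <= t) <= exp(-n z (kappa - mu r)). *)
Lemma survival_partial_sum_ge_expR (dl : R) : 0 < dl ->
  exists2 c, 0 < c & forall t n, 0 <= t -> (1 + dl) * t / mu <= n%:R ->
    1 - expR (- (n%:R * c)) <= survival P (partial_sum xi n) t.
Proof.
move=> dl0; have mu0 : 0 < mu by exact: mean_gt0.
pose r := (1 + dl)^-1.
have rE : r * (1 + dl) = 1 by rewrite /r mulVf//; lra.
have r1 : r < 1 by rewrite /r invf_lt1; lra.
have [z z0 hz] : exists2 z, 0 < z & laplace P (xi 0%N) z <= expR (- (z * (mu * (1 + r) / 2))).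
  by apply: laplace_le_expR; rewrite -mulrA gtr_pMr//; lra.
exists (z * (mu * (1 - r) / 2)) => [|t n t0 nt].
  by rewrite mulr_gt0// divr_gt0// mulr_gt0//; lra.
have tn : t <= n%:R * (mu * r).
  move: nt; rewrite ler_pdivrMr// => nt.
  have r0 : 0 < r by rewrite invr_gt0; lra.
  have -> : t = (1 + dl) * t * r by rewrite mulrAC [_ * r]mulrC rE mul1r.
  by rewrite mulrA ler_wpM2r// ltW.
have [i1 E1] := Rintegral_gt P t (mS n).
have S0 w : 0 <= partial_sum xi n w by apply: sumr_ge0.
have i2 := integrable_expRN P (mS n) S0 (ltW z0).
have i3 : P.-integrable setT (EFin \o (fun w => expR (z * t) * expR (- z * partial_sum xi n w))).
  rewrite (_ : _ \o _ = (fun w => (expR (z * t))%:E * (EFin \o (fun w => expR (- z * partial_sum xi n w))) w)%E)//.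
  exact: integrableZl.
have ic : P.-integrable setT (EFin \o (fun=> 1 : R)) by exact: finite_measure_integrable_cst.
rewrite -lerBrDr opprK -lerBlDl.
have : (\int[P]_w (1 : R) <= \int[P]_w (\1_[set w | (t < partial_sum xi n w)%R] w +
    expR (z * t) * expR (- z * partial_sum xi n w)))%R.
  apply: le_Rintegral => //.
    exact: (integrableD measurableT i1 i3).
  move=> w _; rewrite indicE; have [h|h] := ltP t (partial_sum xi n w).
    by rewrite mem_set//= lerDl mulr_ge0 ?expR_ge0.
  rewrite memNset/=; last by apply/negP; rewrite -leNgt.
  rewrite add0r -expRD mulNr -mulrBr -[leLHS]expR0 ler_expR mulr_ge0 ?(ltW z0)//.
  by rewrite subr_ge0.
rewrite RintegralD// E1 RintegralZl// -/(laplace P _ z) (laplace_partial_sum n iX (X0 0%N) (ltW z0)).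
rewrite Rintegral_cst//= probability_setT/= mulr1.
move=> h; rewrite lerBlDl; apply: (le_trans h); rewrite lerD2l.
apply: (@le_trans _ _ (expR (z * t) * expR (- (z * (mu * (1 + r) / 2))) ^+ n)).
  rewrite ler_pM2l ?expR_gt0//; apply: lerXn2r; rewrite ?nnegrE ?expR_ge0//.
  by apply: Rintegral_ge0 => w _; rewrite expR_ge0.
rewrite -expRM_natl -expRD ler_expR.
have -> : - (n%:R * (z * (mu * (1 - r) / 2))) = z * (n%:R * (mu * r)) + n%:R * - (z * (mu * (1 + r) / 2)).
  by move: (r) => r'; field.
by rewrite lerD2r ler_pM2l.
Qed.

Let tot t : \bar R := (\sum_(0 <= n <oo) (- ln (survival P (partial_sum xi n.+1) t))%:E)%E.

(** Up to N, y = n F(t) is bounded by [A], and 1 - e^(-y) >= y / (1 + y) gives -ln p_n <= A - ln n -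
    ln F(t); the sum of ln n supplies the -1 in beta' - 1. Beyond N the terms are below a geometric
    series independent of t. *)
Lemma sum_survival_le (dl beta beta' C : R) : 0 < dl -> 1 < beta -> 0 < C ->
  (forall t, 0 < t -> F t <= C * t `^ (- beta)) -> 1 < beta' ->
  (exists C t0, forall t, t0 <= t -> - ln (F t) <= beta' * ln t + C) ->
  exists C t0, 0 <= C /\ forall t, t0 <= t ->
    (tot t <= ((1 + dl) * t / mu * ((beta' - 1) * ln t + C) + C)%:E)%E.
Proof.
move=> dl0 b1 C0 HC b'1 [C1 [t0 HL]]; have mu0 : 0 < mu by exact: mean_gt0.
have [c c0 Hc] := survival_partial_sum_ge_expR dl0.
pose D := (1 - expR (- c))^-1.
have D0 : 0 < D by rewrite invr_gt0 subr_gt0 expR_lt1 oppr_lt0.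
have fs := nneseries_expR_lty c0 (ltW D0); set s := (\sum_(_ <= _ <oo) _)%E in fs.
have s0 : (0 <= s)%E.
  by apply: nneseries_ge0 => n _ _; rewrite lee_fin mulr_ge0 ?expR_ge0// ltW.
have sE : s = (fine s)%:E by rewrite fineK// ge0_fin_numE.
pose A := (1 + dl) / mu * C.
pose C4 := `|A + C1 + 1 + ln mu| + fine s.
have fs0 : 0 <= fine s by rewrite fine_ge0.
have C40 : 0 <= C4 by rewrite addr_ge0.
(* For t >= mu / dl, t / mu and (1 + dl) t / mu differ by at least 1, so the integer part N of the
   latter is at least t / mu. *)
exists C4, (Num.max (Num.max 1 t0) (mu / dl)); split => // t.
rewrite !ge_max -andbA => /and3P[t1 tt0 tmu].
have t_gt0 : 0 < t by exact: lt_le_trans t1.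
pose p n := survival P (partial_sum xi n) t.
have pge n : 1 - expR (- (n%:R * F t)) <= p n by exact: survival_partial_sum_ge.
have p0 n : 0 < p n.+1.
  apply: lt_le_trans (pge _).
  by rewrite subr_gt0 expR_lt1 oppr_lt0 mulr_gt0.
have a0 n : 0 <= - ln (p n.+1) by rewrite oppr_ge0 ln_le0// survival_le1.
pose x := (1 + dl) * t / mu.
have x0 : 0 <= x by rewrite divr_ge0 ?(ltW mu0)// mulr_ge0 ?(ltW t_gt0)//; lra.
pose N := Num.truncn x.
have /andP[Nx xN] := truncn_itv x0; rewrite -/N in Nx xN.
have Nt : t / mu <= N%:R.
  have : 1 <= dl * t / mu by rewrite ler_pdivlMr// mul1r mulrC -ler_pdivrMr.
  have : x = t / mu + dl * t / mu by rewrite /x mulrDl mul1r mulrDl.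
  by move: xN; rewrite -natr1; lra.
have N0 : 0 < N%:R :> R by apply: lt_le_trans Nt; rewrite divr_gt0.
have first : \sum_(0 <= n < N) - ln (p n.+1) <=
    x * ((beta' - 1) * ln t + `|A + C1 + 1 + ln mu|).
  apply: (@le_trans _ _ (\sum_(1 <= n < N.+1) (A + (beta' * ln t + C1) - ln n%:R))).
    rewrite big_add1/= big_nat [leRHS]big_nat; apply: ler_sum => n /andP[_ nN].
    set y := n.+1%:R * F t; have y0 : 0 < y by rewrite mulr_gt0.
    have yA : y <= A.
      have nx : n.+1%:R <= x by apply: le_trans Nx; rewrite ler_nat.
      apply: (@le_trans _ _ (x * (C * t `^ (- beta)))).
        by apply: ler_pM => //; [exact/ltW/F0|exact: HC].
      have -> : x * (C * t `^ (- beta)) = A * (t * t `^ (- beta)).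
        by rewrite /x /A; ring.
      have A0 : 0 <= A by rewrite mulr_ge0 ?(ltW C0)// divr_ge0 ?(ltW mu0)//; lra.
      rewrite ler_piMr//.
      rewrite -{1}[t](powRr1 (ltW t_gt0)) -powRD ?(gt_eqF t_gt0) ?implybT//.
      by rewrite -[leRHS](powRr0 t) ler_powR//; lra.
    have y1 : 0 < 1 + y by lra.
    have h1 : y / (1 + y) <= p n.+1.
      apply: le_trans (pge _); rewrite -/y.
      have -> : y / (1 + y) = 1 - (1 + y)^-1 by field; rewrite gt_eqF.
      rewrite lerD2l lerN2 expRN lef_pV2 ?posrE ?expR_gt0//; exact: expR_ge1Dx.
    have h2 : - ln (p n.+1) <= ln (1 + y) - ln y.
      rewrite -[leRHS]opprB -ln_div ?posrE// lerN2 ler_ln ?posrE ?divr_gt0 ?p0//.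
    have h3 : ln (1 + y) <= y by apply: le_ln1Dx; lra.
    have h4 : ln y = ln n.+1%:R + ln (F t) by rewrite lnM ?posrE.
    have h5 := HL _ tt0.
    by move: h2; rewrite h4; lra.
  rewrite big_split/= sumrN sumr_const_nat subn1/=.
  have h1 := sum_ln_ge R N.
  have h2 : ln t - ln mu <= ln (N%:R : R).
    by rewrite -ln_div ?posrE// ler_ln ?posrE ?divr_gt0.
  have lt0 : 0 <= ln t by rewrite ln_ge0.
  apply: (@le_trans _ _ (N%:R * ((beta' - 1) * ln t + (A + C1 + 1 + ln mu)))).
    rewrite -mulr_natl.
    have h3 : N%:R * (ln t - ln mu) <= N%:R * ln (N%:R : R) by rewrite ler_pM2l.
    lra.
  apply: (@le_trans _ _ (N%:R * ((beta' - 1) * ln t + `|A + C1 + 1 + ln mu|))).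
    by rewrite ler_pM2l// lerD2l ler_norm.
  by rewrite ler_wpM2r// addr_ge0// mulr_ge0//; lra.
have totE := @nneseries_split _ (fun n => (- ln (p n.+1))%:E) 0 N.
rewrite /tot totE; last by move=> n _; rewrite lee_fin.
rewrite add0n sumEFin.
have last_ : (\sum_(N <= n <oo) (- ln (p n.+1))%:E <= s)%E.
  rewrite /s (nneseries_split 0 N); last first.
    by move=> n _; rewrite lee_fin mulr_ge0 ?expR_ge0// ltW.
  rewrite add0n; apply: le_trans (leeDr _ _); last first.
    by apply: sume_ge0 => n _; rewrite lee_fin mulr_ge0 ?expR_ge0// ltW.
  have LE n : (N <= n)%N -> ((- ln (p n.+1))%:E <= (D * expR (- (n.+1%:R * c)))%:E)%E.
    move=> Nn; rewrite lee_fin.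
    have h1 : 1 - expR (- (n.+1%:R * c)) <= p n.+1.
      apply: Hc; first exact: ltW.
      by apply: (le_trans (ltW xN)); rewrite ler_nat.
    have cn : c <= n.+1%:R * c by rewrite ler_peMl ?(ltW c0)// ler1n.
    have ec : 0 < 1 - expR (- (n.+1%:R * c)).
      by rewrite subr_gt0 expR_lt1 oppr_lt0 (lt_le_trans c0).
    apply: le_trans (ln_one_sub_expRN_le_expR c0 cn).
    by rewrite lerN2 ler_ln ?posrE ?p0.
  apply: lee_lim.
  - by apply: is_cvg_nneseries => n _ _; rewrite lee_fin.
  - by apply: is_cvg_nneseries => n _ _; rewrite lee_fin mulr_ge0 ?expR_ge0// ltW.
  - apply: nearW => n /=; rewrite big_nat_cond [leRHS]big_nat_cond.
    by apply: lee_sum => k; rewrite andbT => /andP[Nk _]; exact: LE.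
move: first; rewrite -lee_fin => first; apply: (le_trans (leeD first last_)).
rewrite sE -EFinD lee_fin -/x /C4.
have : 0 <= x * fine s by rewrite mulr_ge0.
rewrite addrA mulrDr; have := normr_ge0 (A + C1 + 1 + ln mu); lra.
Qed.

Lemma sum_survival_ge (dl beta C : R) : 0 < dl -> dl < 1 -> 1 < beta -> 0 < C ->
  (forall t, 0 < t -> F t <= C * t `^ (- beta)) ->
  exists C t0, forall t, t0 <= t ->
    (((((1 - dl) * t / mu - 1) * ((beta - 1) * ln t - C))%R)%:E <= tot t)%E.
Proof.
move=> dl0 dl1 b1 C0 HC; have mu0 : 0 < mu by exact: mean_gt0.
have [K K0 HK] := survival_partial_sum_le iX X0 F0 imu b1 dl0 dl1 C0 HC.
(* Beyond this threshold the common lower bound of the terms is nonnegative, so their number may be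
   replaced by the smaller x - 1. *)
exists (ln K), (Num.max 1 (expR (ln K / (beta - 1)))) => t.
rewrite ge_max => /andP[t1 tK]; have t_gt0 : 0 < t by exact: lt_le_trans t1.
have K1 : 0 <= (beta - 1) * ln t - ln K.
  rewrite subr_ge0 mulrC -ler_pdivrMr; last lra.
  by rewrite -[leLHS]expRK ler_ln ?posrE ?expR_gt0.
pose p n := survival P (partial_sum xi n) t.
have p0 n : 0 < p n.+1.
  apply: lt_le_trans (survival_partial_sum_ge n.+1 t iX X0).
  by rewrite subr_gt0 expR_lt1 oppr_lt0 mulr_gt0.
pose x := (1 - dl) * t / mu.
have x0 : 0 <= x by rewrite divr_ge0 ?(ltW mu0)// mulr_ge0 ?(ltW t_gt0)//; lra.
pose M := Num.truncn x.
have /andP[Mx xM] := truncn_itv x0; rewrite -/M in Mx xM.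
have a0 n : 0 <= - ln (p n.+1) by rewrite oppr_ge0 ln_le0// survival_le1.
have totE := @nneseries_split _ (fun n => (- ln (p n.+1))%:E) 0 M.
rewrite /tot totE; last by move=> n _; rewrite lee_fin.
rewrite add0n sumEFin; apply: (@le_trans _ _ (\sum_(0 <= n < M) - ln (p n.+1))%:E); last first.
  by rewrite leeDl// nneseries_ge0// => n _ _; rewrite lee_fin.
rewrite lee_fin; apply: (@le_trans _ _ (\sum_(0 <= n < M) ((beta - 1) * ln t - ln K))).
  rewrite sumr_const_nat subn0 -mulr_natl ler_wpM2r// lerBlDr natr1.
  exact: ltW.
rewrite big_nat [leRHS]big_nat; apply: ler_sum => n /andP[_ nM].
have nx : n.+1%:R <= x by apply: le_trans Mx; rewrite ler_nat.
have h := HK _ _ t1 nx.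
have : ln (p n.+1) <= ln (K * t `^ (1 - beta)).
  by rewrite ler_ln ?posrE ?p0// mulr_gt0// powR_gt0.
rewrite lnM ?posrE ?powR_gt0// ln_powR; lra.
Qed.

End part_b_upper.

(** * Passage to the limit of order t log t *)

Lemma cvg_growth (R : realType) (V : R -> R) (alpha mu : R) : 1 < alpha -> 0 < mu ->
  (forall dl beta, 0 < dl -> alpha < beta -> exists C t0 : R, 0 <= C /\
    forall t : R, t0 <= t -> V t <= (1 + dl) * t / mu * ((beta - 1) * ln t + C) + C) ->
  (forall dl beta, 0 < dl -> dl < 1 -> 1 < beta -> beta < alpha -> exists C t0 : R,
    forall t : R, t0 <= t -> ((1 - dl) * t / mu - 1) * ((beta - 1) * ln t - C) <= V t) ->
  V t / (t * ln t) @[t --> +oo] --> (alpha - 1) / mu.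
Proof.
move=> a1 mu0 ub lb; set L := _ / mu.
have L0 : 0 < L by rewrite divr_gt0//; lra.
have ci : (t : R)^-1 @[t --> +oo] --> (0 : R).
  by apply/gtr0_cvgV0; [exact: nbhs_pinfty_gt|exact: cvg_id].
have cl : (ln t)^-1 @[t --> +oo] --> (0 : R).
  apply/gtr0_cvgV0.
    by near=> t; rewrite ln_gt0//; near: t; exact: nbhs_pinfty_gt.
  apply/cvgryPge => A; near=> t.
  have t_gt0 : 0 < t by near: t; exact: nbhs_pinfty_gt.
  have eAt : expR A <= t by near: t; exact: nbhs_pinfty_ge.
  by rewrite -[A]expRK ler_ln ?posrE ?expR_gt0.
have den : \forall t \near +oo, 0 < t /\ 0 < ln t :> R.
  exists 1; split => // t t1; split; first exact: lt_trans t1.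
  by rewrite ln_gt0.
apply/cvgrPdist_lt => e e0.
(* With margin s, beta - 1 is (alpha - 1)(1 + s) above and (alpha - 1)(1 - s) below. The limits are
   (1 + s)^2 L and (1 - s)^2 L, within e of L by the choice of s. *)
pose s := Num.min (1 / 2) (e / (4 * L)).
have s0 : 0 < s by rewrite lt_min divr_gt0//= divr_gt0// mulr_gt0.
have s1 : s <= 1 / 2 by rewrite ge_min lexx.
have sL' : s <= e / (4 * L) by rewrite /s ge_min lexx orbT.
have sL : s * (4 * L) <= e by rewrite -ler_pdivlMr// mulr_gt0.
have [C [t0 [C0 HU]]] := ub s (1 + (alpha - 1) * (1 + s)) s0 ltac:(nra).
have [C' [t0' HL]] := lb s (1 + (alpha - 1) * (1 - s)) s0 ltac:(lra) ltac:(nra) ltac:(nra).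
have cu : (1 + s) / mu * ((alpha - 1) * (1 + s) + C * (ln t)^-1) + C * (ln t)^-1 * t^-1
    @[t --> +oo] --> (1 + s) / mu * ((alpha - 1) * (1 + s) + C * 0) + C * 0 * 0.
  apply: cvgD; apply: cvgM => //; last by apply: cvgM => //; exact: cvg_cst.
    exact: cvg_cst.
  apply: cvgD; first exact: cvg_cst.
  by apply: cvgM => //; exact: cvg_cst.
have cd : ((1 - s) / mu - t^-1) * ((alpha - 1) * (1 - s) - C' * (ln t)^-1)
    @[t --> +oo] --> ((1 - s) / mu - 0) * ((alpha - 1) * (1 - s) - C' * 0).
  apply: cvgM; apply: cvgB => //; try exact: cvg_cst.
  by apply: cvgM => //; exact: cvg_cst.
have eu : (1 + s) / mu * ((alpha - 1) * (1 + s) + C * 0) + C * 0 * 0 < L + e.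
  rewrite (_ : _ + _ = (1 + s) ^+ 2 * L); last by rewrite /L; ring.
  nra.
have el : L - e < ((1 - s) / mu - 0) * ((alpha - 1) * (1 - s) - C' * 0).
  rewrite (_ : _ * _ = (1 - s) ^+ 2 * L); last by rewrite /L; ring.
  nra.
near=> t.
have [t_gt0 l0] : 0 < t /\ 0 < ln t by near: t.
have tl0 : 0 < t * ln t by rewrite mulr_gt0.
rewrite distrC ltr_distl; apply/andP; split.
  apply: (@lt_le_trans _ _ (((1 - s) / mu - t^-1) * ((alpha - 1) * (1 - s) - C' * (ln t)^-1))).
    by near: t; exact: (cvgr_gt _ cd _ el).
  have tt0 : t0' <= t by near: t; apply: nbhs_pinfty_ge; exact: num_real.
  rewrite ler_pdivlMr//; apply: le_trans (HL t tt0).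
  rewrite le_eqVlt; apply/orP; left; apply/eqP; field.
  by rewrite !gt_eqF.
have tt0 : t0 <= t by near: t; apply: nbhs_pinfty_ge; exact: num_real.
have lt_e : (1 + s) / mu * ((alpha - 1) * (1 + s) + C * (ln t)^-1) + C * (ln t)^-1 * t^-1 < L + e.
  by near: t; exact: (cvgr_lt _ cu _ eu).
apply: le_lt_trans lt_e; rewrite ler_pdivrMr//; apply: (le_trans (HU t tt0)).
rewrite le_eqVlt; apply/orP; left; apply/eqP; field.
by rewrite !gt_eqF.
Unshelve. all: by end_near. Qed.

Section part_b_limit.
Context d (T : measurableType d) (R : realType) (P : probability T R).
Variables (xi : nat -> {RV P >-> R}) (alpha : R).
Hypotheses (iX : iid P xi) (X0 : forall n w, 0 <= xi n w) (a1 : 1 < alpha).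
Let F := survival P (xi 0%N).
Hypothesis F0 : forall t, 0 < F t.
Hypothesis F2 : F (2 * t) / F t @[t --> +oo] --> 2 `^ (- alpha).
Let mxi : measurable_fun setT (xi 0%N). Proof. exact: measurable_funPT. Qed.
Let Fni : {homo F : s t / s <= t >-> t <= s}. Proof. exact: survival_ni. Qed.
Let F1 t : F t <= 1. Proof. exact: survival_le1. Qed.

Lemma mean_integrable : P.-integrable setT (EFin \o xi 0%N).
Proof.
apply/integrableP; split; first exact/measurable_EFinP.
have [b1 ba] : 1 < (1 + alpha) / 2 /\ (1 + alpha) / 2 < alpha by move: (a1) => h; split; lra.
have [C C0 HC] := survival_powR_le Fni F0 F1 F2 (lt_trans ltr01 b1) ba.
have := @moment_lty _ _ _ _ _ _ 1 C mxi (X0 0%N) ltr01 b1 C0 HC.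
rewrite (_ : (\int[P]_w _)%E = (\int[P]_w `|(EFin \o xi 0%N) w|)%E); last first.
  by apply: eq_integral => w _; rewrite powRr1// gee0_abs ?lee_fin.
by [].
Qed.

Let mu : R := \int[P]_w xi 0%N w.

Lemma lne_min_ge1_cvg_tlogt d' (T' : measurableType d') (P' : probability T' R)
    (hatS : nat -> {RV P' >-> R}) :
  independent P' [set n : nat | (1 <= n)%N] hatS ->
  (forall n, (1 <= n)%N -> same_law P' P (hatS n) (partial_sum xi n)) ->
  (- lne (P' [set w | t%:E < min_ge1 hatS w]) / (t * ln t)%:E)%E @[t --> +oo]
    --> ((alpha - 1) / mu)%:E.
Proof.
move=> indS lawS; have imu := mean_integrable.
have mu0 : 0 < mu by exact: mean_gt0.
pose tot t : \bar R := (\sum_(0 <= n <oo) (- ln (survival P (partial_sum xi n.+1) t))%:E)%E.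
have totE t : (- lne (P' [set w | t%:E < min_ge1 hatS w]))%E = tot t.
  exact: lne_min_ge1_partial_sum.
have tot0 t : (0 <= tot t)%E.
  apply: nneseries_ge0 => n _ _; rewrite lee_fin oppr_ge0 ln_le0// survival_le1//.
  exact: partial_sum_measurable.
have ub dl beta : 0 < dl -> alpha < beta -> exists C t0, 0 <= C /\ forall t, t0 <= t ->
    (tot t <= ((1 + dl) * t / mu * ((beta - 1) * ln t + C) + C)%:E)%E.
  move=> dl0 ab.
  have [b1 ba] : 1 < (1 + alpha) / 2 /\ (1 + alpha) / 2 < alpha by move: (a1) => h; split; lra.
  have [C C0 HC] := survival_powR_le Fni F0 F1 F2 (lt_trans ltr01 b1) ba.
  apply: (sum_survival_le iX X0 F0 imu dl0 b1 C0 HC); first exact: lt_trans ab.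
  by apply: (survival_lower_le Fni F0 F2 _ ab); exact: lt_trans a1.
have lb dl beta : 0 < dl -> dl < 1 -> 1 < beta -> beta < alpha -> exists C t0,
    forall t, t0 <= t ->
    (((((1 - dl) * t / mu - 1) * ((beta - 1) * ln t - C))%R)%:E <= tot t)%E.
  move=> dl0 dl1 b1 ba.
  have [C C0 HC] := survival_powR_le Fni F0 F1 F2 (lt_trans ltr01 b1) ba.
  exact: (sum_survival_ge iX X0 F0 imu dl0 dl1 b1 C0 HC).
(* One crude upper bound makes the series finite for large t, which permits real arithmetic through
   [fine]. *)
have [C1 [t1 [_ H1]]] := ub 1 (alpha + 1) ltr01 ltac:(lra).
have totf t : t1 <= t -> tot t = (fine (tot t))%:E.
  by move=> tt1; rewrite fineK// ge0_fin_numE// (le_lt_trans (H1 _ tt1))// ltry.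
have cV : fine (tot t) / (t * ln t) @[t --> +oo] --> (alpha - 1) / mu.
  apply: cvg_growth => //.
  - move=> dl beta dl0 ab; have [C [t0 [C0 H]]] := ub dl beta dl0 ab.
    exists C, (Num.max t0 t1); split => // t; rewrite ge_max => /andP[tt0 tt1].
    by rewrite -lee_fin -totf// H.
  - move=> dl beta dl0 dl1 b1 ba; have [C [t0 H]] := lb dl beta dl0 dl1 b1 ba.
    exists C, (Num.max t0 t1) => t; rewrite ge_max => /andP[tt0 tt1].
    by rewrite -lee_fin -totf// H.
have VE : \forall t \near +oo, (- lne (P' [set w | t%:E < min_ge1 hatS w]) / (t * ln t)%:E)%E
    = (fine (tot t) / (t * ln t))%:E.
  near=> t.
  have tt1 : t1 <= t by near: t; exact: nbhs_pinfty_ge (num_real _).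
  have t_gt1 : 1 < t by near: t; exact: nbhs_pinfty_gt (num_real _).
  have tl : t * ln t != 0 by rewrite gt_eqF// mulr_gt0 ?ln_gt0// (lt_trans _ t_gt1).
  by rewrite totE {1}totf// inver (negbTE tl) -EFinM.
apply: cvg_EFin; first by apply: filterS VE => t ->.
by apply: cvg_trans cV; apply: near_eq_cvg; apply: filterS VE => t /= ->.
Unshelve. all: by end_near. Qed.

End part_b_limit.

Theorem theorem3p5 (R : realType)
    (d : measure_display) (T : measurableType d) (P : probability T R)
    (d' : measure_display) (T' : measurableType d') (P' : probability T' R)
    (xi : nat -> {RV P >-> R}) (hatS : nat -> {RV P' >-> R})
    (alpha : R) (l : R -> R)
    (xi_iid : iid P xi)
    (xi_ge0 : forall n w, 0 <= xi n w)
    (hatS_indep : independent P' [set n : nat | (1 <= n)%N] hatS)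
    (hatS_law : forall n : nat, (1 <= n)%N ->
      same_law P' P (hatS n) (partial_sum xi n))
    (alpha_gt0 : 0 < alpha)
    (l_sv : slowly_varying l)
    (tail : fine (P [set w | t < xi 0%N w]) / (t `^ (- alpha) * l t)
            @[t --> +oo] --> (1 : R)) :
  (alpha < 1 ->
    forall (dW : measure_display) (TW : measurableType dW)
      (Q : probability TW R) (W : R -> {RV Q >-> R}),
    stable_subordinator alpha W ->
    let I := (\int[lebesgue_measure]_(x in `]0%R, +oo[)
        - lne (Q [set w | inverse_process W 1%R w <= x%:E]))%E in
    ((- lne (P' [set w | t%:E < min_ge1 hatS w]) *
        P [set w | (t < xi 0%N w)%R])%E @[t --> +oo] --> I) /\
    (I < +oo)%E) /\
  (1 < alpha ->
    ('E_P[xi 0%N] < +oo)%E /\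
    ((- lne (P' [set w | t%:E < min_ge1 hatS w]) / (t * ln t)%:E)%E
       @[t --> +oo] --> ((alpha - 1)%:E / 'E_P[xi 0%N])%E)).
Proof.

pose F := survival P (xi 0%N).
have mxi : measurable_fun setT (xi 0%N) by exact: measurable_funPT.
have Fni : {homo F : s t / s <= t >-> t <= s} by exact: survival_ni.
(* The slowly varying function disappears here: both cases use the tail through its positivity and
   the limits of F(c t) / F(t). *)
have F0 : forall t, 0 < F t by exact: tail_gt0 Fni l_sv tail.
have FRV c : 0 < c -> F (c * t) / F t @[t --> +oo] --> c `^ (- alpha).
  by move=> c0; exact: regular_ratio F0 l_sv tail c0.
split=> [alpha_lt1 dW TW Q W W_stable I|alpha_gt1].
  by have := lne_min_ge1_cvg_stable xi_iid xi_ge0 alpha_gt0 alpha_lt1 F0 FRV W_stable hatS_indep hatS_law.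
have F2 := FRV 2 (ltr0Sn R 1).
have imu := mean_integrable xi_ge0 alpha_gt1 F0 F2.
have mu0 := mean_gt0 xi_ge0 F0 imu.
have EE : ('E_P[xi 0%N])%E = (\int[P]_w xi 0%N w)%:E.
  by rewrite unlock /Rintegral fineK//; exact: integrable_fin_num.
rewrite EE; split; first exact: ltry.
rewrite inver gt_eqF// -EFinM.
exact: lne_min_ge1_cvg_tlogt.
Qed.
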